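(* Let $N$ be a positive integer and let $\{\psi_j\}_{j=1}^N\subset H^1(SO(3))$ be an orthonormal family such that $\int_{SO(3)}\psi_j(x)\,dx=0$ for all $j$. Let $$\rho(x):=\sum_{j=1}^N|\psi_j(x)|^2,\qquad x\in SO(3).$$ (i) If integration (hence also orthonormality and the $L^2$ norm) is taken with respect to the normalized Haar measure on $SO(3)$, then $$\int_{SO(3)}\rho(x)^{\frac53}\,dx\leq \frac{35}{2\cdot 3^{2/3}}\sum_{j=1}^N\|\nabla\psi_j\|_2^2 .$$ (ii) If instead integration (hence also orthonormality and the $L^2$ norm) is taken with respect to the standard non-normalized Haar measure on $SO(3)$, for which $\mathrm{vol}(SO(3))=\pi^2$, then $$\int_{SO(3)}\rho(x)^{\frac53}\,dx\leq \frac{35}{2\cdot 3^{2/3}\,\pi^{4/3}}\sum_{j=1}^N\|\nabla\psi_j\|_2^2 .$$ In both cases $\nabla\psi=(D_1\psi,D_2\psi,D_3\psi)$ with $D_1,D_2,D_3$ the standard basis of left-invariant vector fields on $SO(3)$.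
   Context: $D_1,D_2,D_3$ are the standard left-invariant vector fields on $SO(3)$, given in local coordinates by the Euler angles $(\phi,\theta,\psi)$ (where $\sin\theta\neq0$) as $$D_1=\cos\psi\,\frac{\partial}{\partial\theta}+\frac{\sin\psi}{\sin\theta}\frac{\partial}{\partial\phi}-\frac{\cos\theta}{\sin\theta}\sin\psi\,\frac{\partial}{\partial\psi},$$ $$D_2=-\sin\psi\,\frac{\partial}{\partial\theta}+\frac{\cos\psi}{\sin\theta}\frac{\partial}{\partial\phi}-\frac{\cos\theta}{\sin\theta}\cos\psi\,\frac{\partial}{\partial\psi},\qquad D_3=\frac{\partial}{\partial\psi}.$$ The positive Laplacian is $\mathcal{L}=-(D_1^2+D_2^2+D_3^2)$; with this normalization its eigenvalues are $\ell(\ell+1)$, $\ell\in\{0,1,2,\dots\}$, with multiplicity $(2\ell+1)^2$. $H^1(SO(3))$ is the Sobolev space of order $1$ of complex-valued functions on $SO(3)$. For $\psi\in H^1(SO(3))$ the gradient is the map $\nabla\psi:SO(3)\to\mathbb{C}^3$, $\nabla\psi(x)=(D_1\psi(x),D_2\psi(x),D_3\psi(x))$, and $\|\nabla\psi\|_2^2=\sum_{i=1}^3\int_{SO(3)}|D_i\psi(x)|^2\,dx$ (with respect to the chosen Haar measure). *)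

(* Defs.v *)
From HB Require Import structures.
From mathcomp Require Import all_boot all_order all_algebra all_fingroup.
From mathcomp Require Import all_classical all_reals all_analysis.
From mathcomp Require Import complex.
From mathcomp Require Import ring lra.

Set Implicit Arguments.
Unset Strict Implicit.
Unset Printing Implicit Defensive.

Import Order.TTheory GRing.Theory Num.Theory.
Import numFieldNormedType.Exports.
Import ComplexField.Normc.

Local Open Scope classical_set_scope.
Local Open Scope ring_scope.

Section SO3_type.
Variable R : realType.

Definition is_rotation : pred 'M[R]_3 :=
  [pred A | (A^T *m A == 1%:M) && (\det A == 1)].

(* The special orthogonal group, with the topology induced from 'M[R]_3 and its
   Borel sigma-algebra. *)
Record SO3 := MkSO3 { SO3val :> 'M[R]_3; _ : is_rotation SO3val }.

HB.instance Definition _ := [isSub for SO3val].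
HB.instance Definition _ := [Choice of SO3 by <:].

Lemma SO3P (x : SO3) : is_rotation (val x).
Proof. exact: valP. Qed.

Lemma rotation1 : is_rotation 1%:M.
Proof. by rewrite /is_rotation /= trmx1 mul1mx det1 !eqxx. Qed.

Lemma rotationM A B : is_rotation A -> is_rotation B -> is_rotation (A *m B).
Proof.
move=> /andP[/eqP oA /eqP dA] /andP[/eqP oB /eqP dB]; apply/andP; split.
  by rewrite trmx_mul mulmxA -(mulmxA B^T) oA mulmx1 oB.
by rewrite det_mulmx dA dB mulr1.
Qed.

Lemma rotationV A : is_rotation A -> is_rotation A^T.
Proof.
move=> /andP[/eqP oA /eqP dA]; apply/andP; split; last by rewrite det_tr dA.
by rewrite trmxK (mulmx1C oA).
Qed.

Definition SO3_one : SO3 := MkSO3 rotation1.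
Definition SO3_mul (x y : SO3) : SO3 := MkSO3 (rotationM (SO3P x) (SO3P y)).
Definition SO3_inv (x : SO3) : SO3 := MkSO3 (rotationV (SO3P x)).

Lemma SO3_mulA : associative SO3_mul.
Proof. by move=> x y z; apply: val_inj; rewrite /= mulmxA. Qed.
Lemma SO3_mul1 : left_id SO3_one SO3_mul.
Proof. by move=> x; apply: val_inj; rewrite /= mul1mx. Qed.
Lemma SO3_1mul : right_id SO3_one SO3_mul.
Proof. by move=> x; apply: val_inj; rewrite /= mulmx1. Qed.
Lemma SO3_mulV : left_inverse SO3_one SO3_inv SO3_mul.
Proof. by move=> x; apply: val_inj => /=; have /andP[/eqP] := SO3P x. Qed.
Lemma SO3_Vmul : right_inverse SO3_one SO3_inv SO3_mul.
Proof.
by move=> x; apply: val_inj => /=; have /andP[/eqP /mulmx1C] := SO3P x.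
Qed.

HB.instance Definition _ := isGroup.Build SO3
  SO3_mulA SO3_mul1 SO3_1mul SO3_mulV SO3_Vmul.
HB.instance Definition _ := isPointed.Build SO3 SO3_one.
HB.instance Definition _ :=
  Topological.copy SO3 (initial_topology (val : SO3 -> 'M[R]_3)).

Definition SO3_borel : set (set SO3) := <<s (@open SO3) >>.

HB.instance Definition _ := @isMeasurable.Build (sigma_display (@open SO3))
  SO3 SO3_borel (@sigma_algebra0 _ setT _) (@sigma_algebraC _ _)
  (@sigma_algebra_bigcup _ setT _).

End SO3_type.

Section left_invariant_fields.
Variable R : realType.

Definition mx3 (rows : seq (seq R)) : 'M[R]_3 :=
  \matrix_(i < 3, j < 3) (nth [::] rows i)`_j.

(* Rotation by the angle t about the k-th coordinate axis, i.e. exp (t * gen k). *)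
Definition rot_mx (k : 'I_3) (t : R) : 'M[R]_3 :=
  nth 0 [:: mx3 [:: [:: 1; 0; 0]; [:: 0; cos t; - sin t]; [:: 0; sin t; cos t]];
            mx3 [:: [:: cos t; 0; sin t]; [:: 0; 1; 0]; [:: - sin t; 0; cos t]];
            mx3 [:: [:: cos t; - sin t; 0]; [:: sin t; cos t; 0]; [:: 0; 0; 1]]] k.

Lemma mulmx3E (A B : 'M[R]_3) i j :
  (A *m B) i j = A i 0 * B 0 j + A i 1 * B 1 j + A i 2 * B 2 j.
Proof.
rewrite mxE !big_ord_recr big_ord0 /= add0r.
by congr (_ + _ + _); congr (A _ _ * B _ _); apply: val_inj.
Qed.

Ltac mx3_tac :=
  apply/matrixP; case; case=> [|[|[|//]]] ? /=; case; case=> [|[|[|//]]] ? /=;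
  rewrite ?(mulmx3E, mxE) /=.

Lemma rot_mx_rotation k t : is_rotation (rot_mx k t).
Proof.
have e := cos2Dsin2 t.
apply/andP; split; apply/eqP.
  by case: k; case=> [|[|[|//]]] ? /=; rewrite /rot_mx /=; mx3_tac; lra.
rewrite (expand_det_row _ 0) !big_ord_recr big_ord0 /= /cofactor.
rewrite !(expand_det_row _ 0) !big_ord_recr !big_ord0 /= /cofactor !det_mx11.
by case: k; case=> [|[|[|//]]] ? /=; rewrite /rot_mx /= !mxE /= ?expr0 ?expr1;
  lra.
Qed.

Definition axis_rot (k : 'I_3) (t : R) : SO3 R := MkSO3 (rot_mx_rotation k t).

(* Left-invariant fields act by right translation along one-parameter
   subgroups. D_euler below recovers their expression in Euler angles. *)
Definition D (k : 'I_3) (f : SO3 R -> R) (x : SO3 R) : R :=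
  derive1 (fun t : R => f (x * axis_rot k t)%g) 0.

Definition gen (k : 'I_3) : 'M[R]_3 :=
  nth 0 [:: mx3 [:: [:: 0; 0; 0]; [:: 0; 0; - 1]; [:: 0; 1; 0]];
            mx3 [:: [:: 0; 0; 1]; [:: 0; 0; 0]; [:: - 1; 0; 0]];
            mx3 [:: [:: 0; - 1; 0]; [:: 1; 0; 0]; [:: 0; 0; 0]]] k.

Lemma rot_mx0 k : rot_mx k 0 = 1%:M.
Proof.
case: k; case=> [|[|[|//]]] ? /=; rewrite /rot_mx /=; mx3_tac;
  by rewrite ?cos0 ?sin0 ?oppr0.
Qed.

Lemma is_derive_mx (c : R -> 'M[R]_3) (t : R) (c' : 'M[R]_3) :
  (forall i j, is_derive t 1 (fun s => c s i j) (c' i j)) -> is_derive t 1 c c'.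
Proof.
move=> h; have d : derivable c t 1 by apply/derivable_mxP => i j; have [] := h i j.
apply: DeriveDef => //; apply/matrixP => i j.
rewrite derive_mx // mxE; exact: derive_val.
Qed.

Lemma is_derive_mulmx (A B : 'M[R]_3) (c : R -> 'M[R]_3) (t : R) c' :
  is_derive t 1 c c' -> is_derive t 1 (fun s => A *m c s *m B) (A *m c' *m B).
Proof.
move=> [d e]; have h i j : is_derive t 1 (fun s => c s i j) (c' i j).
  split; first by move/derivable_mxP: d; exact.
  by rewrite -e derive_mx // mxE.
apply: is_derive_mx => i j.
under eq_fun do rewrite !mulmx3E; rewrite !mulmx3E.
apply: is_derive_eq.
rewrite /GRing.scale /=. ring.
Qed.

Lemma is_derive_rot_mx (k : 'I_3) (t : R) :
  is_derive t 1 (rot_mx k : R -> 'M[R]_3) (rot_mx k t *m gen k).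
Proof.
apply: is_derive_mx => i j.
rewrite mulmx3E.
case: k; case=> [|[|[|//]]] ? /=; rewrite /rot_mx /gen /=;
case: i; case=> [|[|[|//]]] ? /=; case: j; case=> [|[|[|//]]] ? /=; rewrite ?mxE /=;
under eq_fun do rewrite mxE /=; apply: is_derive_eq; rewrite /GRing.scale /=; ring.
Qed.

Lemma gen_rot t :
  [/\ gen 0 *m rot_mx 2 t = rot_mx 2 t *m (cos t *: gen 0 - sin t *: gen 1),
      gen 1 *m rot_mx 2 t = rot_mx 2 t *m (sin t *: gen 0 + cos t *: gen 1),
      gen 2 *m rot_mx 2 t = rot_mx 2 t *m gen 2 &
      gen 2 *m rot_mx 0 t = rot_mx 0 t *m (sin t *: gen 1 + cos t *: gen 2)].
Proof.
have e := cos2Dsin2 t.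
split; rewrite /rot_mx /gen /=; mx3_tac; lra.
Qed.

(* Euler angles in the z-x-z convention. *)
Definition euler (phi theta psi : R) : SO3 R :=
  (axis_rot 2 phi * axis_rot 0 theta * axis_rot 2 psi)%g.

Lemma D_euler (F : 'M[R]_3 -> R) (phi theta psi : R)
    (f := fun x : SO3 R => F (val x)) (x := euler phi theta psi)
    (d_phi := derive1 (fun t => f (euler t theta psi)) phi)
    (d_theta := derive1 (fun t => f (euler phi t psi)) theta)
    (d_psi := derive1 (fun t => f (euler phi theta t)) psi) :
  differentiable F (val x) -> sin theta != 0 ->
  [/\ D 0 f x = cos psi * d_theta + sin psi / sin theta * d_phi
                - cos theta / sin theta * sin psi * d_psi,
      D 1 f x = - sin psi * d_theta + cos psi / sin theta * d_phi
                - cos theta / sin theta * cos psi * d_psi &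
      D 2 f x = d_psi].
Proof.
move=> dF s0.
set E := val x in dF *.
have chain (c : R -> 'M[R]_3) t c' : c t = E -> is_derive t 1 c c' ->
    derive1 (F \o c) t = 'd F E c'.
  move=> ct [dc <-]; rewrite derive1E deriveE; last first.
    apply: differentiable_comp; first exact/derivable1_diffP.
    by rewrite ct.
  rewrite diff_comp ?ct//=; last exact/derivable1_diffP.
  by rewrite deriveE//; exact/derivable1_diffP.
have dD k : D k f x = 'd F E (E *m gen k).
  apply: (chain (fun t => E *m rot_mx k t)); first by rewrite rot_mx0 mulmx1.
  have := is_derive_mulmx E 1%:M (is_derive_rot_mx k 0).
  by under eq_fun do rewrite mulmx1; rewrite mulmx1 rot_mx0 mul1mx.
have [g0 g1 g2 _] := gen_rot psi; have [_ _ _ g2'] := gen_rot theta.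
have EE : E = rot_mx 2 phi *m rot_mx 0 theta *m rot_mx 2 psi by [].
have dpsi : d_psi = 'd F E (E *m gen 2).
  apply: (chain (fun t => rot_mx 2 phi *m rot_mx 0 theta *m rot_mx 2 t)) => //.
  have := is_derive_mulmx (rot_mx 2 phi *m rot_mx 0 theta) 1%:M
    (is_derive_rot_mx 2 psi).
  by under eq_fun do rewrite mulmx1; rewrite mulmx1 !mulmxA.
have dtheta : d_theta = 'd F E (E *m (cos psi *: gen 0 - sin psi *: gen 1)).
  apply: (chain (fun t => rot_mx 2 phi *m rot_mx 0 t *m rot_mx 2 psi)) => //.
  have := is_derive_mulmx (rot_mx 2 phi) (rot_mx 2 psi)
    (is_derive_rot_mx 0 theta).
  by rewrite EE -!mulmxA g0.
have dphi : d_phi = 'd F E (E *m (sin theta *: (sin psi *: gen 0 + cos psi *: gen 1)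
                                  + cos theta *: gen 2)).
  apply: (chain (fun t => rot_mx 2 t *m rot_mx 0 theta *m rot_mx 2 psi)) => //.
  have := is_derive_mulmx 1%:M (rot_mx 0 theta *m rot_mx 2 psi)
    (is_derive_rot_mx 2 phi).
  under eq_fun do rewrite mul1mx mulmxA.
  rewrite mul1mx EE -!mulmxA (mulmxA (gen 2)) g2' -!mulmxA mulmxDl -!scalemxAl.
  by rewrite g1 g2 !scalemxAr -mulmxDr.
have e := cos2Dsin2 psi.
rewrite !dD dpsi dtheta dphi.
rewrite ?(mulmxDr, mulmxBr) -?scalemxAr ?(mulmxDr, mulmxBr) -?scalemxAr.
rewrite !(linearD, linearB, linearZ) /=.
rewrite !(linearD, linearB, linearZ) /= /GRing.scale /=.
set a := 'd F E (E *m gen 0); set b := 'd F E (E *m gen 1); set c := 'd F E _.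
have e' : cos psi ^+ 2 = 1 - sin psi ^+ 2 by rewrite -e; ring.
split=> //; field: e' => //.
Qed.
End left_invariant_fields.

Section analysis_on_SO3.
Variable R : realType.
Implicit Types (phi : SO3 R -> R) (f g : SO3 R -> R[i]).

(* A function on SO(3) is C^oo iff all its iterated derivatives along the global
   frame D 0, D 1, D 2 exist and are continuous. *)
Definition smooth phi : Prop :=
  forall (s : seq 'I_3) (psi := foldr (fun k => @D R k) phi s),
    continuous psi /\
    forall (k : 'I_3) (x : SO3 R),
      derivable (fun t : R => psi (x * axis_rot k t)%g) 0 1.

Variable mu : {measure set (SO3 R) -> \bar R}.

(* Only left invariance is required: right invariance and regularity follow, as
   SO(3) is compact and metrizable. *)
Definition haar_measure : Prop :=
  (0 < mu [set: SO3 R] < +oo)%E /\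
  forall (g : SO3 R) (A : set (SO3 R)), measurable A ->
    mu [set (g * x)%g | x in A] = mu A.

Definition cintegral f : R[i] :=
  Complex (\int[mu]_x complex.Re (f x)) (\int[mu]_x complex.Im (f x)).

Definition L2norm2 f : \bar R := (\int[mu]_x (normc (f x) ^+ 2)%:E)%E.

Definition L2 f : Prop :=
  [/\ measurable_fun setT (fun x => complex.Re (f x)),
      measurable_fun setT (fun x => complex.Im (f x)) &
      (L2norm2 f < +oo)%E].

(* The weak derivative of an L^2 function along D k. The integration by parts
   formula has no boundary or divergence term since Haar measure is
   right-invariant; real test functions suffice, by linearity. *)
Definition is_weak_D (k : 'I_3) f g : Prop :=
  L2 g /\
  forall phi, smooth phi ->
    cintegral (fun x => f x * (D k phi x)%:C%C) =
    - cintegral (fun x => g x * (phi x)%:C%C).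

Definition H1 f : Prop := L2 f /\ forall k, exists g, is_weak_D k f g.

(* A representative of the weak derivative, which is unique up to a null set;
   it is 0 if f has none. *)
Definition weak_D (k : 'I_3) f : SO3 R -> R[i] :=
  xget (fun=> 0) [set g | is_weak_D k f g].

Definition grad f (x : SO3 R) : 'rV[R[i]]_3 := \row_k weak_D k f x.

Definition grad_norm2 f : \bar R :=
  (\sum_(k < 3) L2norm2 (fun x => grad f x ord0 k))%E.

Definition orthonormal_family (N : nat) (psi : 'I_N -> SO3 R -> R[i]) : Prop :=
  forall j k : 'I_N,
    cintegral (fun x => psi j x * (psi k x)^*%C) = (j == k)%:R.

End analysis_on_SO3.

Definition density (R : realType) (N : nat) (psi : 'I_N -> SO3 R -> R[i])
  (x : SO3 R) : R := \sum_(j < N) normc (psi j x) ^+ 2.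

(* Main.v *)
Require Import Defs.
From HB Require Import structures.
From mathcomp Require Import all_boot all_order all_algebra all_fingroup.
From mathcomp Require Import all_classical all_reals all_analysis.
From mathcomp Require Import complex.
From mathcomp Require Import measurable_realfun.
From mathcomp Require Import zify ring lra.

Set Implicit Arguments.
Unset Strict Implicit.
Unset Printing Implicit Defensive.

Import Order.TTheory GRing.Theory Num.Theory.
Import numFieldNormedType.Exports.

Local Open Scope classical_set_scope.
Local Open Scope ring_scope.

(** The proof is Rumin's argument for Lieb-Thirring inequalities, carried out for
    a Haar measure of arbitrary total mass V. Write lambda_n = n (n + 1) for the
    eigenvalues of the positive Laplacian, T_n for the corresponding spectral
    projections and P_L = T_1 + .. + T_L.

    Bessel's inequality for gradients and the completeness of the eigenspaces
    give, for f of mean zero,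
      |grad f|^2 >= sum_n lambda_n <f, T_n f>
                 =  sum_L (lambda_(L+1) - lambda_L) |f - P_L f|^2
    ([sum_defect_le]). Apply this to each psi_j and look at a fixed point x. As
    the family is orthonormal, the density of the functions P_L psi_j at x is at
    most K_L(x, x), where K_L is the kernel of P_L; this number is
    kappa_L = sum_(1 <= n <= L) (2n+1)^2 / V ([levels_kernel_norm]). The triangle
    inequality in C^N then shows that the density of the psi_j - P_L psi_j at x
    is at least (sqrt rho - sqrt kappa_L)_+^2. Since kappa_L <= c lambda_L^(3/2)
    with c = 9 / (2^(3/2) V), an equality for L = 1, the sum over L dominates the
    integral over E > 0 of (sqrt rho - sqrt c E^(3/4))_+^2, which equals
    (9/35) c^(-2/3) rho^(5/3) ([rumin_pointwise]). Integrating in x gives the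
    theorem.

    The harmonic analysis rests on characters alone. T_n is the convolution with
    (2n+1)/V chi_n (tr (x^T y)), where chi_n is a polynomial in one variable, and
    the eigenvalue equation is an identity between such polynomials
    ([rad_laplacian_chi], [lapl_horner]). Projections for distinct eigenvalues
    annihilate each other because the Laplacian is symmetric. The powers of
    (cos (theta / 2))^2 = (1 + tr) / 4 form an approximate identity; they are
    polynomials of the trace, hence combinations of characters. Applied to an
    eigenfunction they show that T_n is idempotent ([eigproj_eigen]), and applied
    to Lipschitz functions they show that the eigenspaces span L^2
    ([defect_cvg0]).

    The kernels, eigenfunctions and test functions are polynomials in the matrix
    entries. They are smooth, so weak derivatives may be tested against them. A
    kernel f (x^-1 y) with f polynomial is a finite sum of products a_i(x) b_i(y), so
    that integrals are exchanged by linearity; this also gives right invariance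
    and integration by parts from left invariance ([haar_int_right],
    [haar_ibp]). *)

(** * Square-integrable functions for a finite measure *)

Section finite_measure_L2.
Import HBNNSimple.
Context d (T : measurableType d) (R : realType).
Variable mu : {measure set T -> \bar R}.
Hypothesis mu_fin : (mu setT < +oo)%E.
Implicit Types f g h : T -> R.

Definition bounded_meas f :=
  measurable_fun setT f /\ exists M, forall x, `|f x| <= M.

Definition sq_integrable f :=
  measurable_fun setT f /\ mu.-integrable setT (fun x => (f x ^+ 2)%:E).

Definition ip f g : R := \int[mu]_x (f x * g x).

Lemma bounded_meas_cst (r : R) : bounded_meas (cst r).
Proof. by split; [exact: measurable_cst | exists `|r|]. Qed.

Lemma bounded_measD f g :
  bounded_meas f -> bounded_meas g -> bounded_meas (f + g).
Proof.
move=> [mf [M fM]] [mg [N gN]]; split; first exact: measurable_funD.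
by exists (M + N) => x; rewrite (le_trans (ler_normD _ _)) // lerD.
Qed.

Lemma bounded_measM f g :
  bounded_meas f -> bounded_meas g -> bounded_meas (f * g).
Proof.
move=> [mf [M fM]] [mg [N gN]]; split; first exact: measurable_funM.
by exists (M * N) => x; rewrite normrM ler_pM.
Qed.

Lemma bounded_meas_integrable f :
  bounded_meas f -> mu.-integrable setT (EFin \o f).
Proof.
move=> [mf [M fM]]; apply: measurable_bounded_integrable => //.
exists M; split; first exact: num_real.
by move=> r Mr x _; exact: le_trans (ltW Mr).
Qed.

Lemma sq_integrable_bounded f : bounded_meas f -> sq_integrable f.
Proof.
move=> bf; split; first by case: bf.
apply: (eq_integrable _ (EFin \o (f * f))) => //.
  by apply: bounded_meas_integrable; apply: bounded_measM.
Qed.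

Lemma sq_integrableM f g : sq_integrable f -> sq_integrable g ->
  mu.-integrable setT (EFin \o (fun x => f x * g x)).
Proof.
move=> [mf f2] [mg g2].
have := integrableD measurableT f2 g2.
apply: le_integrable => //.
  by apply/measurable_EFinP; exact: measurable_funM.
move=> x _ /=; rewrite lee_fin [leRHS]ger0_norm ?addr_ge0 ?sqr_ge0 // normrM.
rewrite -(real_normK (num_real (f x))) -(real_normK (num_real (g x))).
have := sqr_ge0 (`|f x| - `|g x|); have := normr_ge0 (f x); nra.
Qed.

Lemma sq_integrableD f g :
  sq_integrable f -> sq_integrable g -> sq_integrable (f + g).
Proof.
move=> lf lg; have fg := sq_integrableM lf lg.
case: lf => [mf f2]; case: lg => [mg g2].
split; first exact: measurable_funD.
have := integrableD measurableT (integrableD measurableT f2 g2)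
          (integrableZl measurableT 2 fg).
apply: eq_integrable => // x _ /=.
by rewrite -!EFinM -!EFinD; congr (_%:E); rewrite fctE; ring.
Qed.

Lemma sq_integrableMb f g :
  bounded_meas f -> sq_integrable g -> sq_integrable (f * g).
Proof.
move=> [mf [M fM]] [mg g2].
split; first exact: measurable_funM.
have := integrableZl measurableT (M ^+ 2) g2.
apply: le_integrable => //.
  apply/measurable_EFinP; apply: measurable_funX; exact: measurable_funM.
move=> x _ /=; rewrite lee_fin ger0_norm ?sqr_ge0 // ger0_norm; last first.
  by rewrite mulr_ge0 ?sqr_ge0.
rewrite fctE exprMn ler_wpM2r ?sqr_ge0 // -(real_normK (num_real (f x))).
by rewrite ler_sqr ?nnegrE // (le_trans _ (fM x)).
Qed.

Lemma sq_integrableZ r f : sq_integrable f -> sq_integrable (cst r * f).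
Proof. by apply: sq_integrableMb; exact: bounded_meas_cst. Qed.

Lemma sq_integrableN f : sq_integrable f -> sq_integrable (- f).
Proof.
by move=> lf; rewrite -mulN1r (_ : -1 = cst (-1)) //; exact: sq_integrableZ.
Qed.

Lemma sq_integrableB f g :
  sq_integrable f -> sq_integrable g -> sq_integrable (f - g).
Proof. by move=> lf /sq_integrableN; exact: sq_integrableD. Qed.

Lemma sq_integrable0 : sq_integrable 0.
Proof. exact/sq_integrable_bounded/bounded_meas_cst. Qed.

Lemma sq_integrable_sum (I : Type) (s : seq I) (F : I -> T -> R) :
  (forall i, sq_integrable (F i)) -> sq_integrable (\sum_(i <- s) F i).
Proof.
move=> lF; elim/big_ind: _ => //; first exact: sq_integrable0.
exact: sq_integrableD.
Qed.

Lemma ipC f g : ip f g = ip g f.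
Proof. by apply: eq_Rintegral => x _; rewrite mulrC. Qed.

Lemma ipDl f g h : sq_integrable f -> sq_integrable g -> sq_integrable h ->
  ip (f + g) h = ip f h + ip g h.
Proof.
move=> lf lg lh; rewrite /ip -RintegralD ?sq_integrableM//.
by apply: eq_Rintegral => x _; rewrite mulrDl.
Qed.

Lemma ipZl r f h : sq_integrable f -> sq_integrable h ->
  ip (cst r * f) h = r * ip f h.
Proof.
move=> lf lh; rewrite /ip -RintegralZl ?sq_integrableM//.
by apply: eq_Rintegral => x _; rewrite -mulrA.
Qed.

Lemma ip0l h : ip 0 h = 0.
Proof.
rewrite /ip (_ : (fun _ => _) = fun=> 0); first by rewrite Rintegral_cst// mul0r.
by apply/funext => x; rewrite mul0r.
Qed.

Lemma ipNl f h : sq_integrable f -> sq_integrable h -> ip (- f) h = - ip f h.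
Proof. by move=> lf lh; rewrite -mulN1r (_ : -1 = cst (-1)) // ipZl ?mulN1r. Qed.

Lemma ipBl f g h : sq_integrable f -> sq_integrable g -> sq_integrable h ->
  ip (f - g) h = ip f h - ip g h.
Proof. by move=> lf lg lh; rewrite ipDl ?ipNl//; exact: sq_integrableN. Qed.

Lemma ip_suml (I : Type) (s : seq I) (F : I -> T -> R) h :
  (forall i, sq_integrable (F i)) -> sq_integrable h ->
  ip (\sum_(i <- s) F i) h = \sum_(i <- s) ip (F i) h.
Proof.
move=> lF lh; elim: s => [|i s IHs]; first by rewrite !big_nil ip0l.
by rewrite !big_cons ipDl ?IHs//; exact: sq_integrable_sum.
Qed.

Lemma ipDr f g h : sq_integrable f -> sq_integrable g -> sq_integrable h ->
  ip f (g + h) = ip f g + ip f h.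
Proof. by move=> *; rewrite ipC ipDl// ipC [ip h f]ipC. Qed.

Lemma ipBr f g h : sq_integrable f -> sq_integrable g -> sq_integrable h ->
  ip f (g - h) = ip f g - ip f h.
Proof. by move=> *; rewrite ipC ipBl// ipC [ip h f]ipC. Qed.

Lemma ipZr r f h : sq_integrable f -> sq_integrable h ->
  ip f (cst r * h) = r * ip f h.
Proof. by move=> *; rewrite ipC ipZl// ipC. Qed.

Lemma ip_sumr (I : Type) (s : seq I) (F : I -> T -> R) h :
  (forall i, sq_integrable (F i)) -> sq_integrable h ->
  ip h (\sum_(i <- s) F i) = \sum_(i <- s) ip h (F i).
Proof. by move=> *; rewrite ipC ip_suml//; apply: eq_bigr => i _; rewrite ipC. Qed.

Lemma ip_ge0 f : 0 <= ip f f.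
Proof. by apply: Rintegral_ge0 => x _; rewrite -expr2 sqr_ge0. Qed.

Lemma ip_sqrB f g : sq_integrable f -> sq_integrable g ->
  ip (f - g) (f - g) = ip f f - 2 * ip f g + ip g g.
Proof.
move=> lf lg; have lfg := sq_integrableB lf lg.
by rewrite ipBl// !ipBr// (ipC g f); ring.
Qed.

Lemma ip_sqrD f g : sq_integrable f -> sq_integrable g ->
  ip (f + g) (f + g) = ip f f + 2 * ip f g + ip g g.
Proof.
move=> lf lg; have lfg := sq_integrableD lf lg.
by rewrite ipDl// !ipDr// (ipC g f); ring.
Qed.

Lemma L2_dominated_cvg (F : nat -> T -> R) f h : sq_integrable h ->
  (forall n, measurable_fun setT (F n)) -> measurable_fun setT f ->
  (forall n x, `|F n x| <= h x) -> (forall x, F n x @[n --> \oo] --> f x) ->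
  ip (f - F n) (f - F n) @[n --> \oo] --> (0 : R).
Proof.
move=> [mh h2] mF mf Fh Ff.
have ih := integrableZl measurableT 4 h2.
have fh x : `|f x| <= h x.
  have c : `|F n x| @[n --> \oo] --> `|f x| by apply: cvg_norm; exact: Ff.
  rewrite -(cvg_lim _ c) //; apply: limr_le; first by apply/cvg_ex; eexists; exact: c.
  by apply: nearW => n; exact: Fh.
have c0 x : setT x -> (((f x - F n x) ^+ 2)%:E @[n --> \oo] --> 0%:E)%E.
  move=> _; apply: cvg_EFin; first exact: nearW.
  rewrite (_ : (0 : R) = (f x - f x) ^+ 2); last by rewrite subrr expr0n.
  apply: (@cvg_comp _ _ _ (fun n => f x - F n x) (fun y => y ^+ 2)).
    by apply: cvgB; [exact: cvg_cst | exact: Ff].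
  exact: exprn_continuous.
have := @dominated_cvg _ T R mu setT measurableT
  (fun n x => ((f x - F n x) ^+ 2)%:E) (cst 0%:E) (fun x => (4 * h x ^+ 2)%:E).
move=> /(_ _ c0 _ ih) H.
have {}H : (\int[mu]_x ((f x - F n x) ^+ 2)%:E @[n --> \oo] --> 0%:E)%E.
  have := H; rewrite integral0; apply => //.
    move=> n; apply/measurable_EFinP; apply: measurable_funX.
    exact: measurable_funB.
  move=> n x _; rewrite gee0_abs ?lee_fin ?sqr_ge0//.
  rewrite -(real_normK (num_real (f x - _))).
  have := ler_normB (f x) (F n x); have := fh x; have := Fh n x.
  have := normr_ge0 (f x - F n x); nra.
have e n : ip (f - F n) (f - F n) = fine (\int[mu]_x ((f x - F n x) ^+ 2)%:E).
  by [].
under eq_fun do rewrite e.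
exact: fine_cvg H.
Qed.

(** Monotone class argument: indicators of a generating pi-system reach all of
    L^2 through Dynkin's theorem, simple functions and dominated convergence. *)
Lemma L2_induction (G : set (set T)) (P : (T -> R) -> Prop) :
  @measurable _ T = <<s G >> -> setI_closed G ->
  P (cst 1) -> (forall A, G A -> P (\1_A)) ->
  (forall f g, sq_integrable f -> sq_integrable g -> P f -> P g -> P (f + g)) ->
  (forall r f, sq_integrable f -> P f -> P (cst r * f)) ->
  (forall f (F : nat -> T -> R), sq_integrable f ->
    (forall n, sq_integrable (F n)) -> (forall n, P (F n)) ->
    ip (f - F n) (f - F n) @[n --> \oo] --> (0 : R) -> P f) ->
  forall f, sq_integrable f -> P f.
Proof.
move=> GE GI P1 PG PD PZ PL.
have ind_L2 A : measurable A -> sq_integrable (\1_A).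
  move=> mA; apply: sq_integrable_bounded; split => //.
  by exists 1 => x; rewrite indicE ger0_norm // lern1; case: (_ \in _).
have L1 : sq_integrable (cst 1) by exact/sq_integrable_bounded/bounded_meas_cst.
have P0 : P (0 : T -> R).
  have -> : 0 = cst 0 * cst 1 :> (T -> R).
    by apply/funext => x; rewrite !fctE mul0r.
  exact: PZ.
have PA A : measurable A -> P (\1_A).
  rewrite GE; apply: (@dynkin_induction _ T G (fun A => P (\1_A))) => //.
  - by rewrite indicT.
  - move=> S mS PS.
    rewrite (_ : \1_(~` S) = cst 1 + cst (-1) * \1_S); last first.
      apply/funext => x; rewrite indicC !fctE mulN1r indicE.
      by case: (x \in S); rewrite ?subrr ?subr0.
    have lS := ind_L2 S mS.
    apply: PD => //; first exact: sq_integrableZ.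
    exact: PZ.
  - move=> F mF tF PF.
    have tF' : trivIset (fun=> true) F by apply: sub_trivIset tF.
    pose S n := \big[setU/set0]_(i < n) F i.
    have mS n : measurable (S n) by apply: bigsetU_measurable.
    have PS n : P (\1_(S n)).
      elim: n => [|n IHn]; first by rewrite /S big_ord0 indic0.
      rewrite (_ : \1_(S n.+1) = \1_(S n) + \1_(F n)).
        by apply: PD => //; exact: ind_L2.
      apply/funext => x; rewrite /S big_ord_recr /= -/(S n) fctE.
      have := @trivIset_bigsetUI _ xpredT F tF' n n isT (leqnn n).
      rewrite !indicE -/(S n) => /(congr1 (fun A => x \in A)).
      rewrite in_setI in_set0 in_setU.
      by case: (x \in S n); case: (x \in F n) => //= _; rewrite ?addr0 ?add0r.
    apply: (PL _ (fun n => \1_(S n))) => //.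
      by apply: ind_L2; exact: bigcup_measurable.
      by move=> n; exact: ind_L2.
    apply: (L2_dominated_cvg (F := fun n => \1_(S n)) L1) => //.
    + by apply/measurable_indicP; exact: bigcup_measurable.
    + by move=> n x; rewrite indicE ger0_norm // lern1; case: (_ \in _).
    + move=> x; apply: cvg_near_cst.
      have [[i _ Fix]|Fx] := pselect ((\bigcup_k F k) x).
        exists i.+1 => // n /= ltin; rewrite !indicE.
        rewrite !mem_set //; first by exists i.
        by rewrite /S -bigcup_mkord; exists i.
      apply: nearW => n; rewrite !indicE !memNset //.
      by rewrite /S -bigcup_mkord => -[i _ Fix]; apply: Fx; exists i.
have Psum (I : Type) (s : seq I) (F : I -> T -> R) :
    (forall i, sq_integrable (F i)) -> (forall i, P (F i)) ->
    P (\sum_(i <- s) F i).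
  move=> lF PF; elim: s => [|i s IHs]; rewrite ?big_nil ?big_cons //.
  by apply: PD => //; exact: sq_integrable_sum.
have Ppos f : sq_integrable f -> (forall x, 0 <= f x) -> P f.
  move=> lf f0; have mf : measurable_fun setT (EFin \o f).
    by apply/measurable_EFinP; case: lf.
  pose F := nnsfun_approx measurableT mf.
  pose vals n : seq R := finmap.enum_fset (fset_set (range (F n))).
  have FE n : (F n : T -> R) =
      \sum_(i < size (vals n)) cst (vals n)`_i * \1_(F n @^-1` [set (vals n)`_i]).
    by apply/funext => x; rewrite fct_sumE fimfunEord.
  have mFi n y : measurable (F n @^-1` [set y]) by [].
  have lF n : sq_integrable (F n).
    rewrite FE; apply: sq_integrable_sum => i; apply: sq_integrableZ.
    exact: ind_L2.
  apply: (PL _ F) => //.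
    move=> n; rewrite FE; apply: Psum => i.
      by apply: sq_integrableZ; exact: ind_L2.
    by apply: PZ; [exact: ind_L2|exact: PA].
  apply: (L2_dominated_cvg (F := fun n => F n) lf) => //; first by case: lf.
    move=> n x; rewrite ger0_norm // -lee_fin /F nnsfun_approxE.
    by apply: (@le_approx _ _ _ setT (EFin \o f)) => //= y _; rewrite lee_fin.
  move=> x; have := @cvg_nnsfun_approx _ _ _ _ measurableT _ mf _ x Logic.I.
  move=> H; have {}H := H (fun y _ => f0 y : (0 <= (EFin \o f) y)%E).
  exact: (fine_cvg H).
move=> f lf; rewrite -(funrposBneg f).
have labs : sq_integrable f^\+ /\ sq_integrable f^\-.
  case: lf => mf f2.
  have h g : measurable_fun setT g -> (forall x, `|g x| <= `|f x|) ->
      sq_integrable g.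
    move=> mg gf; split=> //; apply: le_integrable f2 => //.
      by apply/measurable_EFinP; exact: measurable_funX.
    by move=> x _ /=; rewrite lee_fin !normrX lerXn2r ?nnegrE.
  split; apply: h.
  - exact: measurable_funrpos.
  - move=> x; rewrite ger0_norm ?funrpos_ge0 //.
    by rewrite /funrpos ge_max ler_norm normr_ge0.
  - exact: measurable_funrneg.
  - move=> x; rewrite ger0_norm ?funrneg_ge0 //.
    by rewrite /funrneg ge_max -normrN ler_norm normr_ge0.
case: labs => lp ln; rewrite (_ : - f^\- = cst (-1) * f^\-); last first.
  by apply/funext => x; rewrite !fctE mulN1r.
apply: PD => //; [exact: sq_integrableZ | exact: Ppos|].
by apply: PZ => //; exact: Ppos.
Qed.

End finite_measure_L2.

(** * Characters of SO(3) as polynomials of the trace *)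

Section characters.
Variable R : realType.
Implicit Types p q : {poly R}.

(** The character sin ((n + 1/2) theta) / sin (theta / 2) of the irreducible
    representation of dimension 2n+1, in the variable t = 1 + 2 cos theta. The
    recursion is the Clebsch-Gordan rule for the product with chi 1. *)
Fixpoint chi (n : nat) : {poly R} :=
  if n is m.+1 then
    if m is k.+1 then ('X - 1) * chi m - chi k else 'X
  else 1.

(** The squared gradient of the trace function, 4 (sin theta)^2, as a polynomial
    of the trace. *)
Definition rad_weight : {poly R} := (3%:R - 'X) * (1 + 'X).

(** The action of the positive Laplacian on functions of the trace, by the chain
    rule: the trace is an eigenfunction for the eigenvalue 2. *)
Definition rad_laplacian p : {poly R} :=
  2%:R * 'X * p^`() - rad_weight * p^`()^`().

Lemma rad_weightE x : rad_weight.[x] = (3 - x) * (1 + x).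
Proof.
by rewrite /rad_weight -polyC_natr hornerM !(hornerD, hornerN, hornerX, hornerC).
Qed.

Lemma rad_laplacianE p x : (rad_laplacian p).[x] =
  2 * x * p^`().[x] - rad_weight.[x] * p^`()^`().[x].
Proof.
rewrite /rad_laplacian -polyC_natr.
by rewrite !(hornerD, hornerN, hornerM, hornerX, hornerC).
Qed.

Lemma chiSS n : chi n.+2 = ('X - 1) * chi n.+1 - chi n.
Proof. by []. Qed.

Lemma mulX_chi n : 'X * chi n.+1 = chi n.+2 + chi n.+1 + chi n.
Proof. by rewrite chiSS; ring. Qed.

(** In terms of theta this expands sin theta * (d/dtheta) chi n on the neighbouring
    characters. It closes the induction for the eigenvalue equation, which
    alone does not control the cross term rad_weight * (chi n)'. *)
Lemma rad_weight_deriv_chi n : rad_weight * (chi n.+1)^`() =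
  - n.+1%:R * chi n.+2 + chi n.+1 + n.+2%:R * chi n.
Proof.
suff: rad_weight * (chi n.+1)^`() =
    - n.+1%:R * chi n.+2 + chi n.+1 + n.+2%:R * chi n /\
  rad_weight * (chi n.+2)^`() =
    - n.+2%:R * chi n.+3 + chi n.+2 + n.+3%:R * chi n.+1 by case.
elim: n => [|n [IH1 IH2]]; split=> //.
- by rewrite /rad_weight /= derivX; ring.
- by rewrite /rad_weight /= !(derivB, derivM, derivX, derivC); ring.
- have -> : (chi n.+3)^`() = ('X - 1) * (chi n.+2)^`() + chi n.+2 - (chi n.+1)^`().
    rewrite (chiSS n.+1) derivB derivM derivB derivX derivC; ring.
  have -> a b c : rad_weight * (('X - 1) * a + b - c) =
    ('X - 1) * (rad_weight * a) + rad_weight * b - rad_weight * c by ring.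
  rewrite IH1 IH2 (chiSS n.+2) (chiSS n.+1) (chiSS n) /rad_weight; ring.
Qed.

Lemma rad_laplacian_chi n :
  rad_laplacian (chi n) = (n * n.+1)%:R * chi n.
Proof.
suff: rad_laplacian (chi n) = (n * n.+1)%:R * chi n /\
      rad_laplacian (chi n.+1) = (n.+1 * n.+2)%:R * chi n.+1 by case.
elim: n => [|n [IH1 IH2]]; split=> //.
- by rewrite /rad_laplacian /= !derivC; ring.
- by rewrite /rad_laplacian /= derivX !derivC; ring.
- have -> : rad_laplacian (chi n.+2) = ('X - 1) * rad_laplacian (chi n.+1)
    - 2%:R * (rad_weight * (chi n.+1)^`()) + 2%:R * 'X * chi n.+1
    - rad_laplacian (chi n).
    rewrite chiSS /rad_laplacian !(derivD, derivN, derivM, derivX, derivC).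
    by ring.
  rewrite IH1 IH2 rad_weight_deriv_chi (chiSS n) !natrM; ring.
Qed.

Lemma chi3 n : (chi n).[3] = (2 * n + 1)%:R.
Proof.
suff: (chi n).[3] = (2 * n + 1)%:R /\ (chi n.+1).[3] = (2 * n.+1 + 1)%:R by case.
elim: n => [|n [IH1 IH2]]; split=> //; first by rewrite hornerE.
  by rewrite hornerE; ring.
by rewrite chiSS !hornerE IH1 IH2; ring.
Qed.

Lemma chi_span p n : (size p <= n.+1)%N ->
  exists c : nat -> R, p = \sum_(m < n.+1) c m *: chi m.
Proof.
pose S n (q : {poly R}) := exists c : nat -> R, q = \sum_(m < n.+1) c m *: chi m.
have SD k q r : S k q -> S k r -> S k (q + r).
  move=> [c ->] [c' ->]; exists (fun m => c m + c' m).
  by rewrite -big_split /=; apply: eq_bigr => m _; rewrite scalerDl.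
have SZ k (a : R) q : S k q -> S k (a *: q).
  move=> [c ->]; exists (fun m => a * c m).
  by rewrite scaler_sumr; apply: eq_bigr => m _; rewrite scalerA.
have Schi k m : (m <= k)%N -> S k (chi m).
  move=> mk; exists (fun i => (i == m)%:R).
  rewrite (bigD1 (Ordinal (mk : (m < k.+1)%N))) //= eqxx scale1r big1 ?addr0 //.
  move=> i; rewrite -val_eqE /= => /negPf ->; exact: scale0r.
have SX k q : S k q -> S k.+1 ('X * q).
  move=> [c ->]; rewrite mulr_sumr; elim/big_ind: _ => //.
  - by rewrite -[0](scale0r (chi 0)); apply/SZ/Schi.
  - by move=> *; exact: SD.
  - move=> [[|m] /= mk] _; rewrite -scalerAr; apply: SZ.
      by rewrite mulr1; exact: (Schi _ 1%N).
    by rewrite mulX_chi; apply: (SD); first apply: (SD);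
      apply: Schi => //; rewrite ltnW // ltnW.
move: p n; suff: forall p n, (size p <= n.+1)%N -> S n p by [].
elim/poly_ind => [|q a IHq] n.
  by move=> _; rewrite -[0](scale0r (chi 0)); apply/SZ/Schi.
rewrite size_MXaddC; have Sa k : S k a%:P.
  by rewrite -[a%:P]mulr1 mul_polyC; apply: (SZ); exact: (Schi _ 0%N).
case: eqP => [-> _|q0 /= szq]; first by rewrite mul0r add0r; exact: Sa.
apply: SD => //; rewrite mulrC; case: n szq => [|n] szq.
  by move: szq q0; rewrite ltnS leqn0 size_poly_eq0 => /eqP ->.
exact/SX/IHq.
Qed.

Lemma sum_odd_sqr n : 3 * \sum_(m < n) (2 * m.+1 + 1)%:R ^+ 2 =
  ((n.+1) * (2 * n + 1) * (2 * n + 3))%:R - 3 :> R.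
Proof.
elim: n => [|n IHn]; first by rewrite big_ord0; ring.
by rewrite big_ord_recr /= mulrDr IHn; ring.
Qed.

End characters.

(** * Polynomial functions of the matrix entries *)

Section polynomial_functions.
Variable R : realType.
Implicit Types (f g : SO3 R -> R) (A B : 'M[R]_3) (x y : SO3 R).

(** The kernels, eigenfunctions and test functions of the proof are all of this
    kind. The algebra is stable under left-invariant derivatives, so its members
    are smooth, and under translations, which act on it through finite sums. *)
Inductive polyf : (SO3 R -> R) -> Prop :=
| polyf_cst r : polyf (cst r)
| polyf_entry i j : polyf (fun x => SO3val x i j)
| polyfD f g : polyf f -> polyf g -> polyf (f + g)
| polyfM f g : polyf f -> polyf g -> polyf (f * g).

Lemma polyfZ r f : polyf f -> polyf (cst r * f).
Proof. by apply: polyfM; exact: polyf_cst. Qed.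

Lemma polyfN f : polyf f -> polyf (- f).
Proof. by rewrite -mulN1r => pf; exact: (polyfZ (-1)). Qed.

Lemma polyfB f g : polyf f -> polyf g -> polyf (f - g).
Proof. by move=> pf /polyfN; exact: polyfD. Qed.

Lemma polyf_sum (I : Type) (s : seq I) (F : I -> SO3 R -> R) :
  (forall i, polyf (F i)) -> polyf (\sum_(i <- s) F i).
Proof.
by move=> pF; elim/big_ind: _ => //; [exact: polyf_cst|exact: polyfD].
Qed.

Definition frob A B : R := \tr (A^T *m B).

Lemma frobE A B : frob A B = \sum_i \sum_j A i j * B i j.
Proof.
rewrite /frob /mxtrace exchange_big /=; apply: eq_bigr => j _.
by rewrite mxE; apply: eq_bigr => i _; rewrite mxE.
Qed.

Lemma frobC A B : frob A B = frob B A.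
Proof.
by rewrite !frobE; apply: eq_bigr => i _; apply: eq_bigr => j _; rewrite mulrC.
Qed.

Lemma polyf_lin A B : polyf (fun x => frob A (SO3val x *m B)).
Proof.
rewrite (_ : (fun _ => _) =
  \sum_i \sum_j cst ((A *m B^T) i j) * (fun x => SO3val x i j)).
  apply: polyf_sum => i; apply: polyf_sum => j.
  by apply: polyfZ; exact: polyf_entry.
apply/funext => x; rewrite /frob mulmxA mxtrace_mulC mulmxA.
rewrite -[B]trmxK -trmx_mul trmxK -/(frob _ _) fct_sumE /= frobE.
by apply: eq_bigr => i _; rewrite fct_sumE.
Qed.

Lemma polyf_horner (p : {poly R}) f : polyf f -> polyf (fun x => p.[f x]).
Proof.
move=> pf; elim/poly_ind: p => [|p c IHp].
  rewrite (_ : (fun _ => _) = cst 0); first exact: polyf_cst.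
  by apply/funext => x; rewrite horner0.
rewrite (_ : (fun _ => _) = (fun x => p.[f x]) * f + cst c).
  by apply: polyfD; [exact: polyfM|exact: polyf_cst].
by apply/funext => x; rewrite hornerMXaddC.
Qed.

Lemma rotP x : (SO3val x)^T *m SO3val x = 1%:M.
Proof. by have /andP[/eqP] := SO3P x. Qed.

Lemma SO3valM x y : SO3val (x * y)%g = SO3val x *m SO3val y.
Proof. by []. Qed.

Lemma SO3valV x : SO3val (x^-1)%g = (SO3val x)^T.
Proof. by []. Qed.

Lemma SO3val1 : SO3val (1%g : SO3 R) = 1%:M.
Proof. by []. Qed.

Lemma SO3val_inj : injective (@SO3val R).
Proof. exact: val_inj. Qed.

Lemma entry_le1 x i j : `|SO3val x i j| <= 1.
Proof.
have := congr1 (fun M : 'M[R]_3 => M j j) (rotP x).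
rewrite !mxE eqxx (bigD1 i) //= mxE => e.
have : 0 <= \sum_(k < 3 | k != i) (SO3val x)^T j k * SO3val x k j.
  by apply: sumr_ge0 => k _; rewrite mxE -expr2 sqr_ge0.
have := real_normK (num_real (SO3val x i j)); have := normr_ge0 (SO3val x i j).
rewrite expr2; nra.
Qed.

Lemma SO3val_continuous : continuous (@SO3val R).
Proof. exact: initial_continuous. Qed.

Lemma polyf_continuous f : polyf f -> continuous f.
Proof.
elim=> {f} [r|i j|f g _ cf _ cg|f g _ cf _ cg] x.
- exact: cst_continuous.
- apply: (@continuous_comp _ _ _ _ (fun M : 'M[R]_3 => M i j)).
    exact: SO3val_continuous.
  exact: coord_continuous.
- by apply: continuousD; [exact: cf|exact: cg].
- by apply: continuousM; [exact: cf|exact: cg].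
Qed.

Lemma open_measurable_SO3 (U : set (SO3 R)) : open U -> measurable U.
Proof. by move=> oU; exact: sub_sigma_algebra. Qed.

Lemma continuous_measurable_SO3 f : continuous f -> measurable_fun setT f.
Proof.
move=> /continuousP cf; apply: (measurability _ (RGenOpens.measurableE R)).
move=> _ [B [a [b ->]] <-]; rewrite setTI; apply: open_measurable_SO3.
by apply: cf; exact: interval_open.
Qed.

Lemma polyf_bounded f : polyf f -> bounded_meas f.
Proof.
move=> pf; split; first by apply: continuous_measurable_SO3; exact: polyf_continuous.
elim: pf => {f} [r|i j|f g _ [M fM] _ [N gN]|f g _ [M fM] _ [N gN]].
- by exists `|r|.
- by exists 1 => x; exact: entry_le1.
- by exists (M + N) => x; rewrite (le_trans (ler_normD _ _)) // lerD.
- by exists (M * N) => x; rewrite normrM ler_pM.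
Qed.

Lemma D_unique h k (d : SO3 R -> R) : (forall x, is_derive (0 : R) (1 : R)
  (fun t : R => h (x * axis_rot k t)%g) (d x : R)) -> D k h = d.
Proof.
by move=> H; apply/funext => x; rewrite /D derive1E; have Hx := H x; exact: derive_val.
Qed.

Lemma axis_rot0 k x : (x * axis_rot k 0)%g = x.
Proof. by apply: SO3val_inj; rewrite SO3valM /= rot_mx0 mulmx1. Qed.

Lemma polyf_derive f : polyf f -> forall k, polyf (D k f) /\
  forall x, is_derive (0 : R) (1 : R) (fun t : R => f (x * axis_rot k t)%g) (D k f x).
Proof.
elim=> {f} [r|i j|f g _ IHf _ IHg|f g pf0 IHf pg0 IHg] k.
- have H x : is_derive (0 : R) (1 : R) (fun t : R => cst r (x * axis_rot k t)%g : R) 0.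
    exact: is_derive_cst.
  by rewrite (D_unique H); split=> //; exact: polyf_cst.
- have H x : is_derive (0 : R) (1 : R)
      (fun t : R => SO3val (x * axis_rot k t)%g i j) ((SO3val x *m gen R k) i j).
    have := is_derive_mulmx (SO3val x) 1%:M (is_derive_rot_mx k (0 : R)).
    under eq_fun do rewrite mulmx1; rewrite mulmx1 rot_mx0 mul1mx => -[Hd He].
    split; first by move/derivable_mxP: Hd; exact.
    by rewrite -He derive_mx // mxE.
  rewrite (D_unique H); split=> //.
  rewrite (_ : (fun _ => _) = \sum_l (fun x => SO3val x i l) * cst (gen R k l j)).
    by apply: polyf_sum => l; apply: polyfM; [exact: polyf_entry|exact: polyf_cst].
  by apply/funext => x; rewrite fct_sumE mxE.
- have [pf Hf] := IHf k; have [pg Hg] := IHg k.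
  have H x : is_derive (0 : R) (1 : R) (fun t : R => (f + g) (x * axis_rot k t)%g)
      ((D k f + D k g) x).
    by have Hfx := Hf x; have Hgx := Hg x; exact: is_deriveD.
  by rewrite (D_unique H); split=> //; exact: polyfD.
- have [pf Hf] := IHf k; have [pg Hg] := IHg k.
  have H x : is_derive (0 : R) (1 : R) (fun t : R => (f * g) (x * axis_rot k t)%g)
      ((D k f * g + f * D k g) x).
    have Hfx := Hf x; have Hgx := Hg x.
    have := is_deriveM Hfx Hgx; rewrite axis_rot0 => Hm.
    apply: is_derive_eq Hm _.
    by rewrite addrC /GRing.scale /= mulrC.
  by rewrite (D_unique H); split=> //; apply: polyfD; exact: polyfM.
Qed.


End polynomial_functions.

(** * The Laplacian on functions of the trace *)

Section laplacian.
Variable R : realType.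
Implicit Types (f g : SO3 R -> R) (A B : 'M[R]_3) (x y : SO3 R) (k : 'I_3).

Lemma polyf_D k f : polyf f -> polyf (D k f).
Proof. by move=> /polyf_derive/(_ k)[]. Qed.

Lemma D_is_derive k f x : polyf f ->
  is_derive (0 : R) (1 : R) (fun t : R => f (x * axis_rot k t)%g) (D k f x).
Proof. by move=> /polyf_derive/(_ k)[]. Qed.

Lemma D_cst k r : D k (cst r) = (0 : SO3 R -> R).
Proof. by apply: D_unique => x; exact: is_derive_cst. Qed.

Lemma D0 k : D k 0 = (0 : SO3 R -> R).
Proof. exact: (D_cst k 0). Qed.

Lemma D_add k f g : polyf f -> polyf g -> D k (f + g) = D k f + D k g.
Proof.
move=> pf pg; apply: D_unique => x.
by apply: is_deriveD; exact: D_is_derive.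
Qed.

Lemma D_mul k f g : polyf f -> polyf g -> D k (f * g) = D k f * g + f * D k g.
Proof.
move=> pf pg; apply: D_unique => x.
have := is_deriveM (D_is_derive k x pf) (D_is_derive k x pg); rewrite axis_rot0.
by move=> Hm; apply: is_derive_eq Hm _; rewrite addrC /GRing.scale /= mulrC.
Qed.

Lemma D_scale k r f : polyf f -> D k (cst r * f) = cst r * D k f.
Proof.
by move=> pf; rewrite D_mul ?D_cst ?mul0r ?add0r//; exact: polyf_cst.
Qed.

Lemma D_sum k (I : Type) (s : seq I) (F : I -> SO3 R -> R) :
  (forall i, polyf (F i)) -> D k (\sum_(i <- s) F i) = \sum_(i <- s) D k (F i).
Proof.
move=> pF; elim: s => [|i s IHs]; first by rewrite !big_nil D0.
by rewrite !big_cons D_add ?IHs//; exact: polyf_sum.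
Qed.

Lemma D_lin k A B :
  D k (fun x => frob A (SO3val x *m B)) = fun x => frob A (SO3val x *m (gen R k *m B)).
Proof.
apply: D_unique => x.
have := is_derive_mulmx (SO3val x) B (is_derive_rot_mx k (0 : R)).
rewrite rot_mx0 mul1mx => -[Hd He].
have H i j : is_derive (0 : R) (1 : R)
    (fun t => (SO3val x *m rot_mx k t *m B) i j) ((SO3val x *m gen R k *m B) i j).
  split; first by move/derivable_mxP: Hd; exact.
  by rewrite -He derive_mx // mxE.
rewrite (_ : (fun _ => _) = fun t : R => \sum_i \sum_j
    A i j * (SO3val x *m rot_mx k t *m B) i j); last first.
  by apply/funext => t; rewrite frobE.
rewrite mulmxA frobE.
have -> : (fun t : R => \sum_i \sum_j A i j * (SO3val x *m rot_mx k t *m B) i j) =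
    \sum_i \sum_j (fun t : R => A i j * (SO3val x *m rot_mx k t *m B) i j).
  by apply/funext => t; rewrite fct_sumE; apply: eq_bigr => i _; rewrite fct_sumE.
by apply: is_derive_sum => i; apply: is_derive_sum => j.
Qed.

Lemma D_horner k (p : {poly R}) f : polyf f ->
  D k (fun x => p.[f x]) = (fun x => p^`().[f x]) * D k f.
Proof.
move=> pf; elim/poly_ind: p => [|p c IHp].
  have -> : (fun x => (0 : {poly R}).[f x]) = cst 0.
    by apply/funext => x; rewrite horner0.
  by rewrite D_cst deriv0; apply/funext => x; rewrite !fctE horner0 mul0r.
have E : (fun x => (p * 'X + c%:P).[f x]) = (fun x => p.[f x]) * f + cst c.
  by apply/funext => x; rewrite hornerMXaddC.
have pp := polyf_horner p pf.
rewrite E D_add ?D_mul//; [|exact: polyfM|exact: polyf_cst].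
rewrite IHp D_cst addr0 derivD derivC addr0 derivM derivX mulr1.
by apply/funext => x; rewrite !fctE hornerD hornerM hornerX; ring.
Qed.

Lemma polyf_smooth f : polyf f -> smooth f.
Proof.
move=> pf s; have : polyf (foldr (fun k => @D R k) f s).
  by elim: s => //= k s; exact: polyf_D.
move=> ps; split; first exact: polyf_continuous.
by move=> k x; have [] := D_is_derive k x ps.
Qed.

Definition lapl f : SO3 R -> R := - \sum_(k < 3) D k (D k f).

Lemma laplD f g : polyf f -> polyf g -> lapl (f + g) = lapl f + lapl g.
Proof.
move=> pf pg; rewrite /lapl -opprD -big_split /=; congr (- _).
by apply: eq_bigr => k _; rewrite D_add// D_add//; exact: polyf_D.
Qed.

Lemma laplZ r f : polyf f -> lapl (cst r * f) = cst r * lapl f.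
Proof.
move=> pf; rewrite /lapl mulrN mulr_sumr; congr (- _).
by apply: eq_bigr => k _; rewrite D_scale// D_scale//; exact: polyf_D.
Qed.

Lemma lapl_sum (I : Type) (s : seq I) (F : I -> SO3 R -> R) :
  (forall i, polyf (F i)) -> lapl (\sum_(i <- s) F i) = \sum_(i <- s) lapl (F i).
Proof.
move=> pF; elim: s => [|i s IHs].
  by rewrite !big_nil /lapl big1 ?oppr0// => k _; rewrite !D0.
by rewrite !big_cons laplD ?IHs//; exact: polyf_sum.
Qed.

Definition rot_trace y x : R := frob (SO3val y) (SO3val x).

Lemma rot_traceC x y : rot_trace x y = rot_trace y x.
Proof. exact: frobC. Qed.

Lemma rot_trace1 x : rot_trace x x = 3.
Proof. by rewrite /rot_trace /frob rotP mxtrace1. Qed.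

Lemma rot_traceMl z x y : rot_trace (z * x)%g (z * y)%g = rot_trace x y.
Proof.
by rewrite /rot_trace /frob !SO3valM trmx_mul mulmxA -(mulmxA (_^T)) rotP mulmx1.
Qed.

Lemma rot_traceE x y : rot_trace x y = rot_trace 1%g (x^-1 * y)%g.
Proof. by rewrite -(rot_traceMl x^-1%g) mulVg. Qed.

Lemma polyf_rot_trace y : polyf (rot_trace y).
Proof.
have := polyf_lin (SO3val y) 1%:M.
by rewrite (_ : (fun _ => _) = rot_trace y)//; apply/funext => x; rewrite mulmx1.
Qed.

Lemma big_ord3 (V : nmodType) (F : 'I_3 -> V) : \sum_i F i = F 0 + F 1 + F 2.
Proof.
rewrite !big_ord_recr big_ord0 /= add0r.
by congr (F _ + F _ + F _); apply: val_inj.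
Qed.

Lemma genE k i j : gen R k i j =
  (if (k == 0) && (i == 1) && (j == 2) then - 1 else
   if (k == 0) && (i == 2) && (j == 1) then 1 else
   if (k == 1) && (i == 0) && (j == 2) then 1 else
   if (k == 1) && (i == 2) && (j == 0) then - 1 else
   if (k == 2) && (i == 0) && (j == 1) then - 1 else
   if (k == 2) && (i == 1) && (j == 0) then 1 else 0).
Proof.
by case: k => [[|[|[|//]]]] ?; rewrite /gen /=; case: i => [[|[|[|//]]]] ?;
   case: j => [[|[|[|//]]]] ?; rewrite mxE.
Qed.

Lemma sum_gen_sqr : \sum_(k < 3) gen R k *m gen R k = (- 2)%:M.
Proof.
apply/matrixP => i j; rewrite big_ord3 !mxE !big_ord3 !genE.
by case: i => [[|[|[|//]]]] ?; case: j => [[|[|[|//]]]] ? /=; rewrite ?mulr0n; ring.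
Qed.

(** The adjugate of a rotation is its transpose; on the diagonal this expresses
    the trace through the principal minors of size two. *)
Lemma trace_rotation_minors x (M := SO3val x) : M 0 0 + M 1 1 + M 2 2 =
  (M 0 0 * M 1 1 - M 0 1 * M 1 0) + (M 0 0 * M 2 2 - M 0 2 * M 2 0) +
  (M 1 1 * M 2 2 - M 1 2 * M 2 1).
Proof.
have adjE : \adj M = M^T.
  have := mul_mx_adj M; have /andP[_ /eqP ->] := SO3P x => e.
  by rewrite -[\adj M]mul1mx -(rotP x) -mulmxA e mulmx1.
have E i : M i i = cofactor M i i.
  by have := congr1 (fun A : 'M[R]_3 => A i i) adjE; rewrite !mxE.
have o (a b : 'I_3) : a = b :> nat -> a = b by exact: val_inj.
have det2 (A : 'M[R]_2) : \det A = A 0 0 * A 1 1 - A 0 1 * A 1 0.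
  rewrite (expand_det_row _ 0) !big_ord_recr big_ord0 /= /cofactor !det_mx11 !mxE.
  rewrite /= expr1 expr0 add0r mul1r mulN1r mulrN.
  by congr (A _ _ * A _ _ - A _ _ * A _ _); apply: val_inj.
have C0 : cofactor M 0 0 = M 1 1 * M 2 2 - M 1 2 * M 2 1.
  rewrite /cofactor det2 !mxE /= expr0 mul1r.
  by congr (M _ _ * M _ _ - M _ _ * M _ _); apply: o.
have C1 : cofactor M 1 1 = M 0 0 * M 2 2 - M 0 2 * M 2 0.
  rewrite /cofactor det2 !mxE /= sqrrN expr1n mul1r.
  by congr (M _ _ * M _ _ - M _ _ * M _ _); apply: o.
have C2 : cofactor M 2 2 = M 0 0 * M 1 1 - M 0 1 * M 1 0.
  rewrite /cofactor det2 !mxE -signr_odd /= mul1r.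
  by congr (M _ _ * M _ _ - M _ _ * M _ _); apply: o.
by rewrite -C0 -C1 -C2 -!E; ring.
Qed.

(** The left side is the squared norm of the skew part of the rotation. It only
    depends on the trace because the columns have norm one and the sum of the
    principal minors of size two is again the trace. *)
Lemma sqr_skew_rotation x :
  \sum_(k < 3) (\tr (SO3val x *m gen R k)) ^+ 2 =
  (3 - \tr (SO3val x)) * (1 + \tr (SO3val x)).
Proof.
have := trace_rotation_minors x; set M := SO3val x.
have E j : M 0 j ^+ 2 + M 1 j ^+ 2 + M 2 j ^+ 2 = 1.
  have := congr1 (fun A : 'M[R]_3 => A j j) (rotP x).
  by rewrite !mxE big_ord3 eqxx !mxE /= => e; lra.
rewrite big_ord3 /mxtrace !big_ord3 !mxE !big_ord3 !genE /=.
have := E 0; have := E 1; have := E 2.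
lra.
Qed.

Lemma D_rot_trace k y :
  D k (rot_trace y) = fun x => frob (SO3val y) (SO3val x *m gen R k).
Proof.
have := D_lin k (SO3val y) 1%:M; rewrite mulmx1.
by rewrite (_ : (fun _ => _) = rot_trace y)//; apply/funext => x; rewrite mulmx1.
Qed.

Lemma sqr_D_rot_trace y x :
  \sum_(k < 3) (D k (rot_trace y) x) ^+ 2 = (rad_weight R).[rot_trace y x].
Proof.
rewrite rad_weightE rot_traceE.
rewrite /rot_trace /frob SO3val1 trmx1 mul1mx -sqr_skew_rotation.
by apply: eq_bigr => k _; rewrite D_rot_trace /frob mulmxA.
Qed.

(** The chain rule reduces the Laplacian of a function of the trace to the two
    numbers computed above: the squared gradient of the trace, and the sum of
    the squares of the generators, a multiple of the identity. *)
Lemma lapl_horner (p : {poly R}) y :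
  lapl (fun x => p.[rot_trace y x]) = fun x => (rad_laplacian p).[rot_trace y x].
Proof.
have pt := polyf_rot_trace y; apply/funext => x.
rewrite /lapl !fctE fct_sumE.
have DD k : D k (D k (fun x => p.[rot_trace y x])) x =
    p^`()^`().[rot_trace y x] * (D k (rot_trace y) x) ^+ 2 +
    p^`().[rot_trace y x] * frob (SO3val y) (SO3val x *m (gen R k *m gen R k)).
  rewrite D_horner// D_mul; [|exact: polyf_horner|exact: polyf_D].
  have -> : D k (D k (rot_trace y)) =
      fun x => frob (SO3val y) (SO3val x *m (gen R k *m gen R k)).
    by rewrite D_rot_trace D_lin.
  by rewrite D_horner// !fctE expr2 mulrA.
rewrite (eq_bigr _ (fun k _ => DD k)) big_split /= -!mulr_sumr sqr_D_rot_trace.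
have -> : \sum_(k < 3) frob (SO3val y) (SO3val x *m (gen R k *m gen R k)) =
    - 2 * rot_trace y x.
  rewrite /frob -raddf_sum -!mulmx_sumr sum_gen_sqr mul_mx_scalar -scalemxAr.
  exact: mxtraceZ.
rewrite rad_laplacianE; ring.
Qed.

End laplacian.

(** * Kernels of finite rank *)

Section degenerate_kernels.
Variable R : realType.
Implicit Types (f g : SO3 R -> R) (K L : SO3 R -> SO3 R -> R) (x y z : SO3 R).

(** With such kernels, exchanging two integrals is exchanging two finite sums, and
    applying the kernel to an L^2 function gives a polynomial function. *)
Definition degenerate K := exists (I : finType) (a b : I -> SO3 R -> R),
  [/\ forall i, polyf (a i), forall i, polyf (b i) &
      forall x y, K x y = \sum_i a i x * b i y].

Lemma degenerate_ext K L : (forall x y, K x y = L x y) -> degenerate K -> degenerate L.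
Proof. by move=> KL [I [a [b [pa pb E]]]]; exists I, a, b; split=> // x y; rewrite -KL. Qed.

Lemma degenerate_prod f g : polyf f -> polyf g -> degenerate (fun x y => f x * g y).
Proof.
move=> pf pg; exists unit, (fun=> f), (fun=> g); split=> // x y.
by rewrite (big_pred1 tt) //; case.
Qed.

Lemma degenerate_cst (r : R) : degenerate (fun _ _ => r).
Proof.
apply: degenerate_ext (degenerate_prod (polyf_cst r) (polyf_cst 1)) => x y /=.
by rewrite mulr1.
Qed.

Lemma degenerateD K L : degenerate K -> degenerate L ->
  degenerate (fun x y => K x y + L x y).
Proof.
move=> [I [a [b [pa pb E]]]] [J [c [d [pc pd F]]]].
exists (I + J)%type, (fun u => match u with inl i => a i | inr j => c j end),
  (fun u => match u with inl i => b i | inr j => d j end).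
split=> [[]//|[]//|x y]; by rewrite big_sumType E F.
Qed.

Lemma degenerateM K L : degenerate K -> degenerate L ->
  degenerate (fun x y => K x y * L x y).
Proof.
move=> [I [a [b [pa pb E]]]] [J [c [d [pc pd F]]]].
exists (I * J)%type, (fun u => a u.1 * c u.2), (fun u => b u.1 * d u.2).
split=> [u|u|x y]; [exact: polyfM|exact: polyfM|].
rewrite E F big_distrlr /= pair_big /=; apply: eq_bigr => u _.
by rewrite !fctE mulrACA.
Qed.

Lemma degenerate_sum (I : Type) (s : seq I) (K : I -> SO3 R -> SO3 R -> R) :
  (forall i, degenerate (K i)) -> degenerate (fun x y => \sum_(i <- s) K i x y).
Proof.
move=> sK; elim: s => [|i s IHs].
  by apply: degenerate_ext (degenerate_cst 0) => x y; rewrite big_nil.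
by apply: degenerate_ext (degenerateD (sK i) IHs) => x y; rewrite big_cons.
Qed.

Lemma degenerate_mul f : polyf f -> degenerate (fun x y => f (x * y)%g).
Proof.
elim=> {f} [r|i j|f g _ sf _ sg|f g _ sf _ sg].
- exact: degenerate_cst.
- have := @degenerate_sum _ (index_enum 'I_3)
    (fun k x y => SO3val x i k * SO3val y k j)
    (fun k => degenerate_prod (polyf_entry R i k) (polyf_entry R k j)).
  by apply: degenerate_ext => x y; rewrite SO3valM mxE.
- exact: degenerateD.
- exact: degenerateM.
Qed.

Lemma degenerate_horner (p : {poly R}) K :
  degenerate K -> degenerate (fun x y => p.[K x y]).
Proof.
move=> sK; elim/poly_ind: p => [|p c IHp].
  by apply: degenerate_ext (degenerate_cst 0) => x y; rewrite horner0.
apply: degenerate_ext (degenerateD (degenerateM IHp sK) (degenerate_cst c)) => x y.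
by rewrite hornerMXaddC.
Qed.

Lemma degenerate_rot_trace : degenerate (@rot_trace R).
Proof.
have s i : degenerate (fun x y : SO3 R => \sum_j SO3val x i j * SO3val y i j).
  by apply: degenerate_sum => j; apply: degenerate_prod; exact: polyf_entry.
by apply: degenerate_ext (degenerate_sum _ s) => x y; rewrite /rot_trace frobE.
Qed.

Lemma degenerate_tr K : degenerate K -> degenerate (fun x y => K y x).
Proof.
move=> [I [a [b [pa pb E]]]]; exists I, b, a; split=> // x y.
by rewrite E; apply: eq_bigr => i _; rewrite mulrC.
Qed.

Lemma degenerate_slice K x : degenerate K -> polyf (K x).
Proof.
move=> [I [a [b [pa pb E]]]].
rewrite (_ : K x = \sum_i cst (a i x) * b i).
  by apply: polyf_sum => i; exact: polyfZ.
by apply/funext => y; rewrite E fct_sumE.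
Qed.

Lemma polyf_inv f : polyf f -> polyf (fun x => f (x^-1)%g).
Proof.
elim=> {f} [r|i j|f g _ pf _ pg|f g _ pf _ pg].
- exact: polyf_cst.
- rewrite (_ : (fun _ => _) = fun x => SO3val x j i); first exact: polyf_entry.
  by apply/funext => x; rewrite SO3valV mxE.
- exact: polyfD.
- exact: polyfM.
Qed.

Lemma polyf_mull z f : polyf f -> polyf (fun x => f (z * x)%g).
Proof. by move/degenerate_mul => s; exact: (degenerate_slice z s). Qed.

Lemma polyf_mulr z f : polyf f -> polyf (fun x => f (x * z)%g).
Proof. by move/degenerate_mul/degenerate_tr => s; exact: (degenerate_slice z s). Qed.

End degenerate_kernels.

(** * The Haar integral and integration by parts *)

Section haar_integral.
Variables (R : realType) (mu : {measure set (SO3 R) -> \bar R}).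
Hypothesis mu_haar : haar_measure mu.
Implicit Types (f g h : SO3 R -> R) (K : SO3 R -> SO3 R -> R) (x y z : SO3 R).

Local Notation ip := (ip mu).
Local Notation L2 := (sq_integrable mu).

Lemma haar_fin : (mu setT < +oo)%E.
Proof. by case: mu_haar => /andP[]. Qed.

Lemma polyf_L2 f : polyf f -> L2 f.
Proof. by move/polyf_bounded/(sq_integrable_bounded haar_fin). Qed.
Hint Resolve polyf_L2 : core.

Lemma left_mul_continuous z : continuous (fun x => (z * x)%g : SO3 R).
Proof.
suff: continuous (fun x : SO3 R => SO3val (z * x)%g).
  exact: (@continuous_comp_initial _ (SO3 R) _ (@SO3val R)).
move=> x; have FF : Filter (nbhs x) := nbhs_filter x.
apply/(@cvg_ballP R _ _ (nbhs x) FF) => e e0.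
have H i j : \forall y \near nbhs x, ball (SO3val (z * x)%g i j) e (SO3val (z * y)%g i j).
  have c := polyf_continuous (polyf_mull z (polyf_entry R i j)).
  exact: ((@cvg_ballP R _ _ (nbhs x) FF _ _).1 (c x) e e0).
have := filter_forall FF (fun i => filter_forall FF (H i)).
by apply: filterS => y Hy; split.
Qed.

Lemma left_mul_measurable z : measurable_fun setT (fun x => (z * x)%g : SO3 R).
Proof.
have /continuousP cg : continuous (fun x => (z * x)%g : SO3 R).
  exact: left_mul_continuous.
apply: (@measurability _ _ _ _ setT _ (@open (SO3 R))) => //.
by move=> _ [B oB <-]; rewrite setTI; apply: open_measurable_SO3; exact: cg.
Qed.

Definition haar_int f := ip f 1.

Lemma haar_intE f : haar_int f = \int[mu]_x f x.
Proof. by apply: eq_Rintegral => x _; exact: mulr1. Qed.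

Lemma haar_int_left z f : polyf f -> haar_int (fun x => f (z * x)%g) = haar_int f.
Proof.
move=> pf; rewrite !haar_intE /Rintegral; congr fine.
have mf := continuous_measurable_SO3 (polyf_continuous pf).
have [_ inv] := mu_haar.
have intf : mu.-integrable setT (EFin \o (fun x => f (z * x)%g)).
  apply: bounded_meas_integrable; first exact: haar_fin.
  exact/polyf_bounded/polyf_mull.
have /measurable_EFinP mEf := mf.
rewrite -(@integral_pushforward _ _ _ _ R _ (left_mul_measurable z) mu setT
  (EFin \o f) mEf intf measurableT).
apply: eq_measure_integral => [|mz A mA _]; first exact: left_mul_measurable.
transitivity (mu [set (z^-1 * x)%g | x in A]); last by rewrite inv.
congr (mu _); apply/seteqP; split=> [x /= Ax|_ /= [x Ax <-]].
  by exists (z * x)%g => //; rewrite mulKg.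
by rewrite /= mulKVg.
Qed.

Definition haar_vol : R := fine (mu setT).

Lemma haar_vol_gt0 : 0 < haar_vol.
Proof.
by rewrite /haar_vol; case: mu_haar => /andP[v0 vy] _; rewrite fine_gt0 ?v0.
Qed.

Lemma haar_int_cst (r : R) : haar_int (cst r) = r * haar_vol.
Proof. by rewrite haar_intE Rintegral_cst. Qed.

Lemma haar_intD f g : polyf f -> polyf g ->
  haar_int (f + g) = haar_int f + haar_int g.
Proof. by move=> pf pg; rewrite /haar_int ipDl//; apply: polyf_L2; [..|exact: polyf_cst]. Qed.

Lemma haar_intZ r f : polyf f -> haar_int (cst r * f) = r * haar_int f.
Proof. by move=> pf; rewrite /haar_int ipZl//; apply: polyf_L2 => //; exact: polyf_cst. Qed.

Lemma haar_intZr r f : polyf f -> haar_int (f * cst r) = haar_int f * r.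
Proof. by move=> pf; rewrite [f * _]mulrC haar_intZ // mulrC. Qed.

Lemma haar_int_sum (I : Type) (s : seq I) (F : I -> SO3 R -> R) :
  (forall i, polyf (F i)) ->
  haar_int (\sum_(i <- s) F i) = \sum_(i <- s) haar_int (F i).
Proof.
by move=> pF; apply: (ip_suml haar_fin) => [i|]; apply: polyf_L2 => //; exact: polyf_cst.
Qed.

(** Left invariance implies invariance under inversion, hence right
    invariance. *)
Lemma haar_int_inv f : polyf f -> haar_int (fun x => f (x^-1)%g) = haar_int f.
Proof.
move=> pf; have [I [a [b [pa pb E]]]] := degenerate_mul pf.
pose nu g := haar_int (fun x => g (x^-1)%g).
(* Both sides times the volume are the double integral of f (x^-1 * y):
   integrating first in x gives nu f, integrating first in y gives the integral
   of f; left invariance is used in each variable. *)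
suff e : nu f * haar_vol = haar_int f * haar_vol.
  by apply: (mulIf _ e); rewrite gt_eqF // haar_vol_gt0.
have pai i : polyf (fun x => a i (x^-1)%g) by exact: polyf_inv.
transitivity (\sum_i nu (a i) * haar_int (b i)).
  rewrite -haar_int_cst.
  have -> : cst (nu f) = \sum_i cst (nu (a i)) * b i.
    apply/funext => y; rewrite fct_sumE /=.
    transitivity (haar_int (fun x => f (x^-1 * y)%g)).
      rewrite /nu -(haar_int_left (y^-1)%g); last exact: polyf_inv.
      by congr haar_int; apply/funext => x; rewrite invMg invgK.
    have -> : (fun x => f (x^-1 * y)%g) =
        \sum_i (fun x => a i (x^-1)%g) * cst (b i y).
      by apply/funext => x; rewrite E fct_sumE.
    rewrite haar_int_sum => [|i]; last by apply: polyfM => //; exact: polyf_cst.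
    by apply: eq_bigr => i _; rewrite haar_intZr.
  rewrite haar_int_sum => [|i]; last exact: polyfZ.
  by apply: eq_bigr => i _; rewrite haar_intZ.
rewrite -haar_int_cst.
have -> : cst (haar_int f) = \sum_i (fun x => a i (x^-1)%g) * cst (haar_int (b i)).
  apply/funext => x; rewrite fct_sumE /=.
  rewrite -(haar_int_left (x^-1)%g pf).
  have -> : (fun y => f (x^-1 * y)%g) = \sum_i cst (a i (x^-1)%g) * b i.
    by apply/funext => y; rewrite E fct_sumE.
  rewrite haar_int_sum => [|i]; last exact: polyfZ.
  by apply: eq_bigr => i _; rewrite haar_intZ.
rewrite haar_int_sum => [|i]; last by apply: polyfM => //; exact: polyf_cst.
by apply: eq_bigr => i _; rewrite haar_intZr.
Qed.

Lemma haar_int_right z f : polyf f -> haar_int (fun x => f (x * z)%g) = haar_int f.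
Proof.
move=> pf; rewrite -haar_int_inv; last exact: polyf_mulr.
rewrite -[RHS]haar_int_inv // -[RHS](haar_int_left (z^-1)%g); last exact: polyf_inv.
by congr haar_int; apply/funext => x; rewrite invMg invgK.
Qed.

(** Differentiate the constant y |-> integral of f (x * y) at the identity. The
    derivative passes under the integral because f (x * y) is a finite sum of
    products a_i x * b_i y. *)
Lemma haar_int_D k f : polyf f -> haar_int (D k f) = 0.
Proof.
move=> pf; have [I [a [b [pa pb E]]]] := degenerate_mul pf.
have DE : D k f = \sum_i a i * cst (D k (b i) 1%g).
  apply/funext => x; transitivity (D k (\sum_i cst (a i x) * b i) 1%g).
    rewrite /D; congr (derive1 _ 0); apply/funext => t.
    by rewrite E fct_sumE mul1g.
  rewrite D_sum => [|i]; last exact: polyfZ.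
  by rewrite !fct_sumE; apply: eq_bigr => i _; rewrite D_scale.
have cE : cst (haar_int f) = \sum_i cst (haar_int (a i)) * b i.
  apply/funext => y; rewrite /= -(haar_int_right y pf).
  have -> : (fun x => f (x * y)%g) = \sum_i a i * cst (b i y).
    by apply/funext => x; rewrite E fct_sumE.
  rewrite haar_int_sum => [|i]; last by apply: polyfM => //; exact: polyf_cst.
  by rewrite fct_sumE; apply: eq_bigr => i _; rewrite haar_intZr.
rewrite DE haar_int_sum => [|i]; last by apply: polyfM => //; exact: polyf_cst.
transitivity (D k (cst (haar_int f)) 1%g); last by rewrite D_cst.
rewrite cE D_sum => [|i]; last exact: polyfZ.
by rewrite fct_sumE; apply: eq_bigr => i _; rewrite D_scale// haar_intZr.
Qed.

Lemma haar_ibp k f g : polyf f -> polyf g -> ip (D k f) g = - ip f (D k g).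
Proof.
move=> pf pg; apply/eqP; rewrite -addr_eq0; apply/eqP.
have pDf := polyf_D k pf; have pDg := polyf_D k pg.
have e u v : ip u v = haar_int (u * v).
  by rewrite haar_intE.
rewrite !e -haar_intD; [|exact: polyfM|exact: polyfM].
by rewrite -D_mul// haar_int_D//; exact: polyfM.
Qed.

Lemma ip_lapl f g : polyf f -> polyf g ->
  ip (lapl f) g = \sum_(k < 3) ip (D k f) (D k g).
Proof.
move=> pf pg; rewrite /lapl.
have pDD k : polyf (D k (D k f)) by do 2 apply: polyf_D.
rewrite ipNl; [|exact/polyf_L2/polyf_sum|exact: polyf_L2].
rewrite (ip_suml haar_fin); [|by move=> k; exact: polyf_L2|exact: polyf_L2].
rewrite -sumrN; apply: eq_bigr => k _; rewrite haar_ibp ?opprK //.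
exact: polyf_D.
Qed.

Lemma lapl_sym f g : polyf f -> polyf g -> ip (lapl f) g = ip f (lapl g).
Proof.
move=> pf pg; rewrite [RHS]ipC [RHS](ip_lapl pg pf) [LHS](ip_lapl pf pg).
by apply: eq_bigr => k _; rewrite ipC.
Qed.

Definition integral_op K h : SO3 R -> R := fun x => ip (K x) h.

Lemma integral_opE (I : finType) (a b : I -> SO3 R -> R) K h :
  (forall i, polyf (b i)) -> (forall x y, K x y = \sum_i a i x * b i y) -> L2 h ->
  integral_op K h = \sum_i cst (ip (b i) h) * a i.
Proof.
move=> pb E lh; apply/funext => x; rewrite /integral_op.
have -> : K x = \sum_i cst (a i x) * b i.
  by apply/funext => y; rewrite E fct_sumE.
rewrite (ip_suml haar_fin) => [|i|//]; last exact/polyf_L2/polyfZ.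
rewrite fct_sumE; apply: eq_bigr => i _; have lb := polyf_L2 (pb i).
by rewrite (ipZl _ lb lh) mulrC.
Qed.

Lemma polyf_integral_op K h : degenerate K -> L2 h -> polyf (integral_op K h).
Proof.
move=> [I [a [b [pa pb E]]]] lh; rewrite (integral_opE pb E lh).
by apply: polyf_sum => i; exact: polyfZ.
Qed.

Lemma integral_op_exchange K f h : degenerate K -> L2 f -> L2 h ->
  ip f (integral_op K h) = ip (integral_op (fun y x => K x y) f) h.
Proof.
move=> [I [a [b [pa pb E]]]] lf lh; rewrite (integral_opE pb E lh).
have E' y x : K x y = \sum_i b i y * a i x.
  by rewrite E; apply: eq_bigr => i _; rewrite mulrC.
rewrite (integral_opE pa E' lf) (ip_sumr haar_fin) => [|i|//]; last exact/polyf_L2/polyfZ.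
rewrite (ip_suml haar_fin) => [|i|//]; last exact/polyf_L2/polyfZ.
apply: eq_bigr => i _; have la := polyf_L2 (pa i); have lb := polyf_L2 (pb i).
by rewrite (ipZr _ lf la) (ipZl _ lb lh) (ipC mu f (a i)) mulrC.
Qed.

Lemma lapl_integral_op K h : degenerate K -> L2 h ->
  lapl (integral_op K h) = integral_op (fun x y => lapl (K^~ y) x) h.
Proof.
move=> [I [a [b [pa pb E]]]] lh; rewrite (integral_opE pb E lh).
have E' x y : lapl (K^~ y) x = \sum_i lapl (a i) x * b i y.
  have -> : K^~ y = \sum_i cst (b i y) * a i.
    by apply/funext => z; rewrite E fct_sumE; apply: eq_bigr => i _; rewrite mulrC.
  rewrite lapl_sum => [|i]; last exact: polyfZ.
  by rewrite fct_sumE; apply: eq_bigr => i _; rewrite laplZ// !fctE mulrC.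
rewrite (integral_opE pb E' lh) lapl_sum => [|i]; last exact: polyfZ.
by apply: eq_bigr => i _; rewrite laplZ.
Qed.

End haar_integral.

(** * Convolution with functions of the trace *)

Section zonal_kernels.
Variables (R : realType) (mu : {measure set (SO3 R) -> \bar R}).
Hypothesis mu_haar : haar_measure mu.
Implicit Types (f g h : SO3 R -> R) (x y z : SO3 R) (p q : {poly R}).

Local Notation ip := (ip mu).
Local Notation L2 := (sq_integrable mu).
Local Notation V := (haar_vol mu).

Definition zonal p x y : R := p.[rot_trace x y].

Lemma degenerate_zonal p : degenerate (zonal p).
Proof. exact: degenerate_horner (degenerate_rot_trace R). Qed.

Lemma polyf_zonal p x : polyf (zonal p x).
Proof. exact: (degenerate_slice x (degenerate_zonal p)). Qed.

Lemma zonal_L2 p x : L2 (zonal p x).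
Proof. exact/(polyf_L2 mu_haar)/polyf_zonal. Qed.

Lemma zonalC p x y : zonal p x y = zonal p y x.
Proof. by rewrite /zonal rot_traceC. Qed.

Lemma zonal_tr p : (fun y x => zonal p x y) = zonal p.
Proof. by apply/funext => y; apply/funext => x; rewrite zonalC. Qed.

Lemma lapl_zonal p x : lapl (zonal p x) = zonal (rad_laplacian p) x.
Proof. exact: lapl_horner. Qed.

Lemma conv_zonal_sym p f h : L2 f -> L2 h ->
  ip f (integral_op mu (zonal p) h) = ip (integral_op mu (zonal p) f) h.
Proof.
move=> lf lh; rewrite (integral_op_exchange mu_haar (degenerate_zonal p) lf lh).
by rewrite zonal_tr.
Qed.

Lemma lapl_conv_zonal p h : L2 h ->
  lapl (integral_op mu (zonal p) h) = integral_op mu (zonal (rad_laplacian p)) h.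
Proof.
move=> lh; rewrite (lapl_integral_op mu_haar (degenerate_zonal p) lh).
congr (integral_op mu _ h); apply/funext => x; apply/funext => y.
rewrite -[(zonal p)^~ y]/((fun z x => zonal p x z) y) zonal_tr lapl_zonal.
exact: zonalC.
Qed.

Lemma polyf_conv_zonal p h : L2 h -> polyf (integral_op mu (zonal p) h).
Proof. exact: (polyf_integral_op mu_haar (degenerate_zonal p)). Qed.

Lemma conv_zonalZ r p h : L2 h ->
  integral_op mu (zonal (r *: p)) h = cst r * integral_op mu (zonal p) h.
Proof.
move=> lh; apply/funext => x; rewrite /integral_op.
rewrite (_ : zonal (r *: p) x = cst r * zonal p x); last first.
  by apply/funext => y; rewrite /zonal hornerZ.
by rewrite (ipZl _ (zonal_L2 p x) lh).
Qed.

Lemma conv_zonalD p q h : L2 h ->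
  integral_op mu (zonal (p + q)) h = integral_op mu (zonal p) h + integral_op mu (zonal q) h.
Proof.
move=> lh; apply/funext => x; rewrite /integral_op.
rewrite (_ : zonal (p + q) x = zonal p x + zonal q x); last first.
  by apply/funext => y; rewrite /zonal hornerD.
by rewrite (ipDl (zonal_L2 p x) (zonal_L2 q x) lh).
Qed.

Lemma conv_zonal_sum (I : Type) (s : seq I) (F : I -> {poly R}) h : L2 h ->
  integral_op mu (zonal (\sum_(i <- s) F i)) h = \sum_(i <- s) integral_op mu (zonal (F i)) h.
Proof.
move=> lh; elim: s => [|i s IHs].
  rewrite !big_nil -[0](scale0r 1) conv_zonalZ //.
  by apply/funext => x; exact: mul0r.
by rewrite !big_cons conv_zonalD // IHs.
Qed.

Lemma haar_int_zonal p x : haar_int mu (zonal p x) = haar_int mu (zonal p 1%g).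
Proof.
rewrite -(haar_int_left mu_haar x (polyf_zonal p x)); congr (haar_int mu).
by apply/funext => y; rewrite /zonal -[X in rot_trace X _]mulg1 rot_traceMl.
Qed.

Lemma ip_zonal p q x : ip (zonal p x) (zonal q x) = haar_int mu (zonal (p * q) 1%g).
Proof.
rewrite -(haar_int_zonal _ x) haar_intE; apply: eq_Rintegral => y _.
by rewrite /zonal hornerM.
Qed.

Lemma haar_int_lapl f : polyf f -> haar_int mu (lapl f) = 0.
Proof.
move=> pf; rewrite /haar_int (ip_lapl mu_haar pf (polyf_cst 1)).
by rewrite big1 // => k _; rewrite D_cst ipC ip0l.
Qed.

(** Eigenfunctions of the symmetric operator lapl for distinct eigenvalues are
    orthogonal; the convolution with chi n is a family of such inner products. *)
Lemma conv_chi_eigen n (lam : R) f : polyf f -> lapl f = cst lam * f ->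
  (n * n.+1)%:R != lam -> integral_op mu (zonal (chi R n)) f = 0.
Proof.
move=> pf ef nlam; apply/funext => x; rewrite /integral_op /=.
have pz := polyf_zonal (chi R n) x.
have := lapl_sym mu_haar pz pf; rewrite ef lapl_zonal rad_laplacian_chi.
have -> : zonal ((n * n.+1)%:R * chi R n) x = cst (n * n.+1)%:R * zonal (chi R n) x.
  by apply/funext => y; rewrite /zonal -polyC_natr hornerM hornerC.
have lz := zonal_L2 (chi R n) x; have lf := polyf_L2 mu_haar pf.
rewrite (ipZl _ lz lf) (ipZr _ lz lf) => /eqP; rewrite -subr_eq0 -mulrBl mulf_eq0.
by rewrite subr_eq0 (negPf nlam) => /eqP.
Qed.

Lemma lapl_zonal_chi n x :
  lapl (zonal (chi R n) x) = cst (n * n.+1)%:R * zonal (chi R n) x.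
Proof.
rewrite lapl_zonal rad_laplacian_chi; apply/funext => y.
by rewrite /zonal -polyC_natr hornerM hornerC.
Qed.

Lemma eigenvalue_inj n m :
  ((n * n.+1)%:R == (m * m.+1)%:R :> R) = (n == m).
Proof.
rewrite eqr_nat; apply/eqP/eqP => [e|-> //].
case: (ltngtP n m) => // h.
  have : (n * n.+1 < m * m.+1)%N by apply: ltn_mul.
  by rewrite e ltnn.
have : (m * m.+1 < n * n.+1)%N by apply: ltn_mul.
by rewrite e ltnn.
Qed.

Lemma ip_chi_neq n m x : n != m ->
  ip (zonal (chi R n) x) (zonal (chi R m) x) = 0.
Proof.
move=> nm; have h : (n * n.+1)%:R != (m * m.+1)%:R :> R by rewrite eigenvalue_inj.
have := conv_chi_eigen (polyf_zonal (chi R m) x) (lapl_zonal_chi m x) h.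
by move=> /(congr1 (fun F : SO3 R -> R => F x)).
Qed.

(** Multiplying by the trace sends chi n to the sum of chi n and its two
    neighbours; moving this factor across the inner product shows that all the
    characters have the same norm. *)
Lemma ip_chi_eq n x : ip (zonal (chi R n) x) (zonal (chi R n) x) = V.
Proof.
suff Jn m : ip (zonal (chi R m.+1) x) (zonal (chi R m.+1) x) =
            ip (zonal (chi R m) x) (zonal (chi R m) x).
  elim: n => [|n <-] //; rewrite -[RHS]mul1r -haar_int_cst haar_intE.
  by apply: eq_Rintegral => y _; rewrite /zonal /= hornerC mulr1.
have lz k : L2 (zonal (chi R k) x) by exact: zonal_L2.
have E k : zonal ('X * chi R k.+1) x =
    zonal (chi R k.+2) x + zonal (chi R k.+1) x + zonal (chi R k) x.
  apply/funext => y; rewrite /zonal mulX_chi (hornerD (chi R k.+2 + _)).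
  by rewrite (hornerD (chi R k.+2)).
have n1 k : k != k.+1 by rewrite neq_ltn ltnSn.
have n2 k : k != k.+2 by rewrite neq_ltn (ltn_trans (ltnSn k) (ltnSn _)).
have up k : ip (zonal (chi R k) x) (zonal ('X * chi R k.+1) x) =
    ip (zonal (chi R k) x) (zonal (chi R k) x).
  rewrite E ipDr //; last exact: sq_integrableD.
  by rewrite ipDr // (ip_chi_neq x (n2 k)) (ip_chi_neq x (n1 k)) !add0r.
rewrite -(up m) !ip_zonal.
transitivity (ip (zonal (chi R m.+1) x) (zonal ('X * chi R m) x)); last first.
  rewrite ip_zonal (_ : chi R m.+1 * _ = chi R m * ('X * chi R m.+1)) //.
  by rewrite mulrCA [RHS]mulrCA; congr ('X * _); exact: mulrC.
rewrite -(ip_zonal _ _ x); case: m => [|m].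
  by rewrite mulr1.
rewrite E ipDr //; last exact: sq_integrableD.
rewrite ipDr // (@ip_chi_neq m.+2 m.+1) ?(@ip_chi_neq m.+2 m) ?addr0 //.
  by rewrite eq_sym n2.
by rewrite eq_sym n1.
Qed.

End zonal_kernels.

(** * A polynomial approximate identity *)

Section approximate_identity.
Variables (R : realType) (mu : {measure set (SO3 R) -> \bar R}).
Hypothesis mu_haar : haar_measure mu.
Implicit Types (f g h : SO3 R -> R) (x y z : SO3 R) (p q : {poly R}).

Local Notation ip := (ip mu).
Local Notation L2 := (sq_integrable mu).
Local Notation V := (haar_vol mu).

(** The square of cos (theta / 2) in terms of the trace 1 + 2 cos theta. *)
Definition half_angle : {poly R} := 4^-1 *: (1 + 'X).

Lemma half_angleE t : half_angle.[t] = (1 + t) / 4.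
Proof. by rewrite /half_angle hornerZ hornerD hornerC hornerX mulrC. Qed.

Lemma rot_trace_le3 x y : rot_trace x y <= 3.
Proof.
rewrite rot_traceE /rot_trace /frob SO3val1 trmx1 mul1mx /mxtrace big_ord3.
set M := SO3val _; have le1 i : M i i <= 1.
  by rewrite (le_trans (ler_norm _)) // entry_le1.
by have := le1 0; have := le1 1; have := le1 2; lra.
Qed.

(** The product (3 - t) (1 + t) is a sum of squares and 3 - t is nonnegative. *)
Lemma rot_trace_geN1 x y : -1 <= rot_trace x y.
Proof.
have := rot_trace_le3 x y; have := sqr_D_rot_trace x y; rewrite rad_weightE => e.
have : 0 <= (3 - rot_trace x y) * (1 + rot_trace x y).
  by rewrite -e; apply: sumr_ge0 => k _; exact: sqr_ge0.
nra.
Qed.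

Lemma half_angle_ge0 x y : 0 <= half_angle.[rot_trace x y].
Proof. by rewrite half_angleE; have := rot_trace_geN1 x y; lra. Qed.

Lemma rad_laplacian_half_angle N t :
  (rad_laplacian (half_angle ^+ N.+1)).[t] =
  N.+1%:R * (N.+2%:R * half_angle.[t] ^+ N.+1 - (N%:R + 2^-1) * half_angle.[t] ^+ N).
Proof.
have d1 : half_angle^`() = (4^-1)%:P.
  by rewrite /half_angle derivZ derivD derivC derivX add0r -mul_polyC mulr1.
have dX k : (half_angle ^+ k.+1)^`() = (k.+1%:R / 4) *: half_angle ^+ k.
  by rewrite deriv_exp d1 /= mul_polyC -scaler_nat scalerA.
have w16 : (rad_weight R).[t] = 16 * half_angle.[t] * (1 - half_angle.[t]).
  by rewrite rad_weightE half_angleE; field.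
have tE : t = 4 * half_angle.[t] - 1 by rewrite half_angleE; field.
rewrite rad_laplacianE dX derivZ w16.
case: N => [|N].
  by rewrite expr0 derivC scaler0 horner0 hornerZ hornerC {1}tE; field.
rewrite dX !(hornerZ (_%:R / 4)) !horner_exp {1}tE; set u := half_angle.[t].
by rewrite !exprS; field.
Qed.

Definition moment N : R := haar_int mu (zonal (half_angle ^+ N) 1%g).

Lemma moment0 : moment 0 = V.
Proof.
rewrite -[RHS]mul1r -haar_int_cst; congr (haar_int mu).
by apply/funext => y; rewrite /zonal expr0 hornerC.
Qed.

(** The Laplacian of half_angle ^+ N.+1 has integral zero; this yields the moments
    without any explicit formula for the Haar measure. *)
Lemma momentS N : N.+2%:R * moment N.+1 = (N%:R + 2^-1) * moment N.
Proof.
have pz k : polyf (zonal (half_angle ^+ k) 1%g) by exact: polyf_zonal.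
have := haar_int_lapl mu_haar (pz N.+1); rewrite lapl_zonal.
have -> : zonal (rad_laplacian (half_angle ^+ N.+1)) 1%g =
    cst N.+1%:R * (cst N.+2%:R * zonal (half_angle ^+ N.+1) 1%g +
    cst (- (N%:R + 2^-1)) * zonal (half_angle ^+ N) 1%g).
  apply/funext => y; rewrite /zonal rad_laplacian_half_angle !fctE.
  by rewrite !horner_exp; ring.
rewrite (haar_intZ mu_haar) ?(haar_intD mu_haar) ?(haar_intZ mu_haar) //;
  do ?[exact: polyfZ | apply: polyfD].
move=> /eqP; rewrite mulf_eq0 pnatr_eq0 /= -/(moment _) -/(moment _).
by rewrite mulNr subr_eq0 => /eqP.
Qed.

Lemma moment_gt0 N : 0 < moment N.
Proof.
elim: N => [|N IHN]; first by rewrite moment0 (haar_vol_gt0 mu_haar).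
have : 0 < N.+2%:R * moment N.+1.
  by rewrite momentS mulr_gt0 // ltr_wpDl.
by rewrite pmulr_rgt0.
Qed.

(** Convolution with a power of (cos (theta / 2))^2, normalized to mass one. The
    kernel concentrates at the identity and, being a polynomial of the trace,
    is a combination of characters. *)
Definition approx_id N g x := (moment N)^-1 * integral_op mu (zonal (half_angle ^+ N)) g x.

(** By Jensen's inequality for the probability density of the kernel, the squared
    error is at most the mean of C * (3 - t), and 3 - t = 4 (1 - half_angle) has
    mean 4 (1 - moment N.+1 / moment N) = 6 / (N + 2). *)
Lemma approx_id_bound N g (C : R) x : bounded_meas g ->
  (forall y, (g y - g x) ^+ 2 <= C * (3 - rot_trace x y)) ->
  (approx_id N g x - g x) ^+ 2 <= 6 * C / N.+2%:R.
Proof.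
move=> bg gC; set w := zonal (half_angle ^+ N) x.
have fin := haar_fin mu_haar.
have bp f : polyf f -> bounded_meas f by exact: polyf_bounded.
have pw : polyf w by exact: polyf_zonal.
have bw := bp _ pw.
have bc r : bounded_meas (cst r : SO3 R -> R) by exact: bounded_meas_cst.
have bL f : bounded_meas f -> L2 f by exact: sq_integrable_bounded.
have m0 := moment_gt0 N.
have wm : ip w (cst 1) = moment N by exact: (haar_int_zonal mu_haar).
pose d := g - cst (g x).
have bd : bounded_meas d.
  by rewrite (_ : d = g + cst (- g x)) //; exact: bounded_measD.
pose c := ip w d / moment N.
have -> : approx_id N g x - g x = c.
  rewrite /approx_id /integral_op -/w /c /d.
  rewrite (ipBr (bL _ bw) (bL _ bg) (bL _ (bc _))).
  have -> : ip w (cst (g x)) = g x * moment N.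
    rewrite -wm -(ipZr _ (bL _ bw) (bL _ (bc 1))); congr (ip w _).
    by apply/funext => y; rewrite !fctE mulr1.
  by field; rewrite gt_eqF.
have bdd : bounded_meas (d * d) by exact: bounded_measM.
have jensen : c ^+ 2 * moment N <= ip w (d * d).
  pose e := d - cst c.
  have : 0 <= ip w (e * e).
    apply: Rintegral_ge0 => y _; rewrite mulr_ge0 //.
      by rewrite /w /zonal horner_exp exprn_ge0 // half_angle_ge0.
    by rewrite -expr2 sqr_ge0.
  have -> : e * e = (d * d + cst (- 2 * c) * d) + cst (c ^+ 2) * cst 1.
    by apply/funext => y; rewrite /e !fctE; ring.
  have Lw := bL _ bw; have Ld := bL _ bd; have L1 := bL _ (bc 1).
  rewrite ipDr //; [|apply: sq_integrableD; [exact: bL|exact: sq_integrableZ]|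
    exact: sq_integrableZ].
  rewrite ipDr //; [|exact: bL|exact: sq_integrableZ].
  rewrite !ipZr // wm (_ : ip w d = c * moment N); last first.
    by rewrite /c; field; rewrite gt_eqF.
  by move=> h; rewrite -subr_ge0; apply: le_trans h _; rewrite le_eqVlt; apply/orP; left; apply/eqP; ring.
pose gap : SO3 R -> R := cst 3 - rot_trace x.
have bgap : bounded_meas gap.
  by apply: bp; apply: polyfB; [exact: polyf_cst|exact: polyf_rot_trace].
have up : ip w (d * d) <= C * ip w gap.
  rewrite -(ipZr _ (bL _ bw) (bL _ bgap)).
  apply: le_Rintegral => //.
  - apply: (bounded_meas_integrable fin); exact: (bounded_measM bw bdd).
  - apply: (bounded_meas_integrable fin (bounded_measM bw _)).
    exact: bounded_measM.
  - move=> y _; apply: ler_wpM2l; last by rewrite /d !fctE -expr2; exact: gC.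
    by rewrite /w /zonal horner_exp exprn_ge0 // half_angle_ge0.
have gapE : ip w gap = 4 * (moment N - moment N.+1).
  transitivity (haar_int mu (cst 4 * zonal (half_angle ^+ N) x +
      cst (- 4) * zonal (half_angle ^+ N.+1) x)).
    rewrite haar_intE; apply: eq_Rintegral => y _.
    by rewrite /w /gap /zonal !fctE exprS hornerM half_angleE; field.
  have pz k : polyf (zonal (half_angle ^+ k) x) by exact: polyf_zonal.
  rewrite (haar_intD mu_haar) ?(haar_intZ mu_haar) //; do ?[exact: polyfZ].
  by rewrite !(haar_int_zonal mu_haar _ x) /moment; ring.
have key : c ^+ 2 * moment N <= C * (4 * (moment N - moment N.+1)).
  by rewrite -gapE; exact: le_trans up.
have e : moment N.+1 = (N%:R + 2^-1) * moment N / N.+2%:R.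
  by rewrite -momentS mulrC mulKf // pnatr_eq0.
rewrite -(ler_pM2r m0); apply: le_trans key _.
rewrite e le_eqVlt; apply/orP; left; apply/eqP; field.
by rewrite gt_eqF //; have := ler0n R N; lra.
Qed.

End approximate_identity.

(** * Spectral projections *)

Section spectral_projections.
Variables (R : realType) (mu : {measure set (SO3 R) -> \bar R}).
Hypothesis mu_haar : haar_measure mu.
Implicit Types (f g h : SO3 R -> R) (x y z : SO3 R) (p q : {poly R}).

Local Notation ip := (ip mu).
Local Notation L2 := (sq_integrable mu).
Local Notation V := (haar_vol mu).

(** Since 3 - rot_trace x y is half the squared Euclidean distance of the two
    matrices, this is a Lipschitz condition, in the form that the approximate
    identity uses. *)
Definition trace_lipschitz g := bounded_meas g /\
  exists C : R, 0 <= C /\ forall x y, (g y - g x) ^+ 2 <= C * (3 - rot_trace x y).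

Lemma frob_dist x y : \sum_i \sum_j (SO3val y i j - SO3val x i j) ^+ 2 =
  2 * (3 - rot_trace x y).
Proof.
have E z : \sum_i \sum_j SO3val z i j ^+ 2 = 3.
  by rewrite -(rot_trace1 z) /rot_trace frobE.
transitivity (\sum_i \sum_j SO3val y i j ^+ 2 + \sum_i \sum_j SO3val x i j ^+ 2
   + \sum_i \sum_j (-2) * (SO3val x i j * SO3val y i j)).
  rewrite -!big_split; apply: eq_bigr => i _ /=; rewrite -!big_split.
  by apply: eq_bigr => j _ /=; ring.
rewrite !E /rot_trace frobE; under [X in _ + X]eq_bigr do rewrite -mulr_sumr.
by rewrite -mulr_sumr; ring.
Qed.

Lemma entry_dist x y i j :
  (SO3val y i j - SO3val x i j) ^+ 2 <= 2 * (3 - rot_trace x y).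
Proof.
rewrite -frob_dist (bigD1 i) //= (bigD1 j) //= -addrA lerDl.
by rewrite addr_ge0 // sumr_ge0 // => k _; rewrite ?sumr_ge0 // => *; exact: sqr_ge0.
Qed.

Lemma polyf_trace_lipschitz f : polyf f -> trace_lipschitz f.
Proof.
move=> pf; split; first exact: polyf_bounded.
have gap x y : 0 <= 3 - rot_trace x y by rewrite subr_ge0; exact: rot_trace_le3.
elim: pf => {f} [r|i j|f g pf [A [A0 fA]] pg [B [B0 gB]]|f g pf [A [A0 fA]] pg [B [B0 gB]]].
- by exists 0; split=> // x y; rewrite subrr expr0n mul0r.
- by exists 2; split=> // x y; exact: entry_dist.
- exists (2 * (A + B)); split=> [|x y]; first by lra.
  rewrite !fctE; have := fA x y; have := gB x y.
  have := sqr_ge0 ((f y - f x) - (g y - g x)); nra.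
- have [_ [M fM]] := polyf_bounded pf; have [_ [N gN]] := polyf_bounded pg.
  exists (2 * (N ^+ 2 * A + M ^+ 2 * B)); split=> [|x y].
    by rewrite mulr_ge0 // addr_ge0 // mulr_ge0 // sqr_ge0.
  rewrite !fctE.
  have -> : f y * g y - f x * g x = g y * (f y - f x) + f x * (g y - g x) by ring.
  have sqrM (u : R) (K v : R) : `|u| <= K -> (u * v) ^+ 2 <= K ^+ 2 * v ^+ 2.
    move=> uK; rewrite exprMn ler_wpM2r ?sqr_ge0 // -(real_normK (num_real u)).
    by rewrite ler_sqr ?nnegrE // (le_trans _ uK).
  have h1 := sqrM _ _ (f y - f x) (gN y); have h2 := sqrM _ _ (g y - g x) (fM x).
  have h3 : N ^+ 2 * (f y - f x) ^+ 2 <= N ^+ 2 * (A * (3 - rot_trace x y)).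
    by rewrite ler_wpM2l ?sqr_ge0.
  have h4 : M ^+ 2 * (g y - g x) ^+ 2 <= M ^+ 2 * (B * (3 - rot_trace x y)).
    by rewrite ler_wpM2l ?sqr_ge0.
  have := sqr_ge0 (g y * (f y - f x) - f x * (g y - g x)); lra.
Qed.

Lemma sqr_dist_cvg (u : nat -> R) (l K : R) :
  (forall n, (u n - l) ^+ 2 <= K / n.+2%:R) -> u n @[n --> \oo] --> l.
Proof.
move=> uK; apply/cvgrPdist_le => e e0.
have K0 : 0 <= K.
  by have := le_trans (sqr_ge0 _) (uK 0); rewrite pmulr_lge0 // invr_gt0.
near=> n; rewrite distrC -(ler_sqr (normr_ge0 _)) ?nnegrE ?(ltW e0) //.
rewrite real_normK ?num_real // (le_trans (uK n)) // ler_pdivrMr //.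
rewrite -ler_pdivrMl ?exprn_gt0 //.
have : K / e ^+ 2 <= n%:R by near: n; exact: nbhs_infty_ger.
rewrite mulrC => /le_trans; apply.
by rewrite ler_nat; apply: leqW; apply: leqW.
Unshelve. all: end_near.
Qed.

Lemma approx_id_cvg g x : trace_lipschitz g ->
  approx_id mu n g x @[n --> \oo] --> g x.
Proof.
move=> [bg [C [C0 gC]]]; apply: (@sqr_dist_cvg _ _ (6 * C)) => n.
exact: (approx_id_bound mu_haar).
Qed.

Definition chi_kernel n : {poly R} := ((2 * n + 1)%:R / V) *: chi R n.

(** The spectral projection of lapl for the eigenvalue n * (n + 1). *)
Definition eigproj n f : SO3 R -> R := integral_op mu (zonal (chi_kernel n)) f.

Let V0 : V != 0.
Proof. by rewrite gt_eqF // haar_vol_gt0. Qed.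

Lemma polyf_eigproj n f : L2 f -> polyf (eigproj n f).
Proof. exact: polyf_conv_zonal. Qed.

Lemma eigproj_L2 n f : L2 f -> L2 (eigproj n f).
Proof. by move=> lf; apply/(polyf_L2 mu_haar)/polyf_eigproj. Qed.

Lemma eigprojE n f : L2 f -> eigproj n f =
  cst ((2 * n + 1)%:R / V) * integral_op mu (zonal (chi R n)) f.
Proof. exact: conv_zonalZ. Qed.

Lemma lapl_eigproj n f : L2 f ->
  lapl (eigproj n f) = cst (n * n.+1)%:R * eigproj n f.
Proof.
move=> lf; rewrite /eigproj lapl_conv_zonal //.
rewrite -conv_zonalZ //; congr (integral_op mu (zonal _) f).
have -> : rad_laplacian (chi_kernel n) = ((2 * n + 1)%:R / V) *: rad_laplacian (chi R n).
  by rewrite /chi_kernel /rad_laplacian !derivZ scalerBr !scalerAr.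
by rewrite rad_laplacian_chi -polyC_natr mul_polyC /chi_kernel !scalerA mulrC.
Qed.

Lemma eigproj_sym n f g : L2 f -> L2 g -> ip f (eigproj n g) = ip (eigproj n f) g.
Proof. exact: conv_zonal_sym. Qed.

Lemma eigprojD n f g : L2 f -> L2 g -> eigproj n (f + g) = eigproj n f + eigproj n g.
Proof.
move=> lf lg; apply/funext => x.
exact: (ipDr (zonal_L2 mu_haar _ x) lf lg).
Qed.

Lemma eigprojZ n r f : L2 f -> eigproj n (cst r * f) = cst r * eigproj n f.
Proof. by move=> lf; apply/funext => x; exact: (ipZr _ (zonal_L2 mu_haar _ x) lf). Qed.

Lemma eigproj_sum n (I : Type) (s : seq I) (F : I -> SO3 R -> R) :
  (forall i, L2 (F i)) ->
  eigproj n (\sum_(i <- s) F i) = \sum_(i <- s) eigproj n (F i).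
Proof.
move=> lF; apply/funext => x; rewrite [RHS](congr1 (@^~ x) (fct_sumE _ _ _)).
exact: (ip_sumr (haar_fin mu_haar) _ lF (zonal_L2 mu_haar _ x)).
Qed.

Lemma eigproj_eigen_neq n m f : polyf f -> lapl f = cst (m * m.+1)%:R * f ->
  n != m -> eigproj n f = 0.
Proof.
move=> pf ef nm; rewrite eigprojE; last exact: (polyf_L2 mu_haar).
by rewrite (conv_chi_eigen mu_haar pf ef) ?mulr0 // eigenvalue_inj.
Qed.

Lemma approx_id_span N : exists c : nat -> R, forall h, L2 h ->
  approx_id mu N h = \sum_(m < N.+1) cst (c m) * eigproj m h.
Proof.
have sz : (size ((half_angle R) ^+ N) <= N.+1)%N.
  apply: leq_trans (size_poly_exp_leq _ _) _.
  rewrite ltnS -[leqRHS]mul1n leq_mul2r; apply/orP; right.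
  rewrite /half_angle size_scale ?invr_eq0 ?pnatr_eq0 //.
  by rewrite addrC -[1]opprK -polyCN size_XsubC.
have [c cE] := chi_span sz.
exists (fun m => (moment mu N)^-1 * c m * ((2 * m + 1)%:R / V)^-1) => h lh.
transitivity (cst (moment mu N)^-1 * integral_op mu (zonal (half_angle R ^+ N)) h) => //.
rewrite cE conv_zonal_sum // mulr_sumr; apply: eq_bigr => m _.
rewrite conv_zonalZ // eigprojE //; apply/funext => x; rewrite !fctE.
field; rewrite V0 (gt_eqF (moment_gt0 mu_haar N)) /=.
by have := ler0n R m; rewrite gt_eqF //; lra.
Qed.

(** The approximate identity acts on each eigenspace as a multiple of the
    corresponding projection. The multiple is the same for all eigenfunctions, so
    it is computed in the limit from chi n itself. *)
Lemma eigproj_eigen n f : polyf f -> lapl f = cst (n * n.+1)%:R * f ->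
  eigproj n f = f.
Proof.
have scaling h N : polyf h -> lapl h = cst (n * n.+1)%:R * h -> (n <= N)%N ->
  forall c : nat -> R, (forall g, L2 g -> approx_id mu N g = \sum_(m < N.+1) cst (c m) * eigproj m g) ->
  approx_id mu N h = cst (c n) * eigproj n h.
  move=> ph eh nN c cE; rewrite cE; last exact: (polyf_L2 mu_haar).
  rewrite (bigD1 (Ordinal (nN : (n < N.+1)%N))) //= big1 ?addr0 // => m mn.
  by rewrite (eigproj_eigen_neq ph eh) ?mulr0.
move=> pf ef; apply/funext => x.
pose k := zonal (chi R n) (1%g : SO3 R).
have pk : polyf k by exact: polyf_zonal.
have ek : lapl k = cst (n * n.+1)%:R * k by exact: lapl_zonal_chi.
have k1 : k 1%g = (2 * n + 1)%:R by rewrite /k /zonal rot_trace1 chi3.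
have Tk1 : eigproj n k 1%g = k 1%g.
  rewrite (eigprojE n (polyf_L2 mu_haar pk)) k1.
  have -> : integral_op mu (zonal (chi R n)) k = fun y => ip (zonal (chi R n) y) k by [].
  by rewrite fctE (ip_chi_eq mu_haar n 1%g) /= divfK.
have k10 : k 1%g != 0 by rewrite k1 pnatr_eq0 addn1.
apply: (mulIf k10); apply/esym.
have c1 : (approx_id mu N f x * k 1%g) @[N --> \oo] --> f x * k 1%g.
  by apply: cvgMr_tmp; apply: approx_id_cvg; exact: polyf_trace_lipschitz.
have c2 : (eigproj n f x * approx_id mu N k 1%g) @[N --> \oo] --> eigproj n f x * k 1%g.
  by apply: cvgMl_tmp; apply: approx_id_cvg; exact: polyf_trace_lipschitz.
have c3 : (approx_id mu N f x * k 1%g) @[N --> \oo] --> eigproj n f x * k 1%g.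
  apply: cvg_trans c2; apply: near_eq_cvg; exists n => // N /= nN.
  have [c cE] := approx_id_span N.
  rewrite (scaling f N pf ef nN c cE) (scaling k N pk ek nN c cE) !fctE Tk1.
  by ring.
exact: (cvg_unique _ c1 c3).
Qed.

Lemma eigproj_eigproj n m f : L2 f ->
  eigproj n (eigproj m f) = if n == m then eigproj m f else 0.
Proof.
move=> lf; have pf := polyf_eigproj m lf; have ef := lapl_eigproj m lf.
by case: eqP => [->|/eqP nm]; [exact: eigproj_eigen | exact: eigproj_eigen_neq ef nm].
Qed.

End spectral_projections.

(** * The distance to the low eigenspaces *)

Section completeness.
Variables (R : realType) (mu : {measure set (SO3 R) -> \bar R}).
Hypothesis mu_haar : haar_measure mu.
Implicit Types (f g h : SO3 R -> R) (x y z : SO3 R).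

Local Notation ip := (ip mu).
Local Notation L2 := (sq_integrable mu).
Local Notation V := (haar_vol mu).
Local Notation eigproj := (eigproj mu).

Definition spectral_sum L f : SO3 R -> R := \sum_(n < L) eigproj n f.

Definition defect L f : R := ip (f - spectral_sum L f) (f - spectral_sum L f).

Lemma polyf_spectral_sum L f : L2 f -> polyf (spectral_sum L f).
Proof. by move=> lf; apply: polyf_sum => n; exact: polyf_eigproj. Qed.

Lemma spectral_sum_L2 L f : L2 f -> L2 (spectral_sum L f).
Proof. by move=> lf; apply/(polyf_L2 mu_haar)/polyf_spectral_sum. Qed.

Lemma spectral_sumD L f g : L2 f -> L2 g ->
  spectral_sum L (f + g) = spectral_sum L f + spectral_sum L g.
Proof.
move=> lf lg; rewrite /spectral_sum -big_split /=.
by apply: eq_bigr => n _; exact: eigprojD.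
Qed.

Lemma spectral_sumZ L r f : L2 f ->
  spectral_sum L (cst r * f) = cst r * spectral_sum L f.
Proof.
move=> lf; rewrite /spectral_sum mulr_sumr.
by apply: eq_bigr => n _; exact: eigprojZ.
Qed.

Lemma eigproj_spectral_sum n L f : L2 f ->
  eigproj n (spectral_sum L f) = if (n < L)%N then eigproj n f else 0.
Proof.
move=> lf; rewrite /spectral_sum eigproj_sum // => [|m]; last exact: eigproj_L2.
under eq_bigr do rewrite eigproj_eigproj //.
case: ifPn => nL; last first.
  by rewrite big1 // => m _; case: eqP => // nm; move: nL; rewrite nm ltn_ord.
rewrite (bigD1 (Ordinal nL)) //= eqxx big1 ?addr0 // => m.
by rewrite -val_eqE /= eq_sym => /negPf ->.
Qed.

Lemma spectral_sum_eigproj n L f : L2 f -> (n < L)%N ->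
  spectral_sum L (eigproj n f) = eigproj n f.
Proof.
move=> lf nL; rewrite /spectral_sum; under eq_bigr do rewrite eigproj_eigproj //.
rewrite (bigD1 (Ordinal nL)) //= eqxx big1 ?addr0 // => m.
by rewrite -val_eqE /= => /negPf ->.
Qed.

Lemma ip_spectral_sum L f : L2 f ->
  ip (spectral_sum L f) (spectral_sum L f) = ip f (spectral_sum L f).
Proof.
move=> lf; have lS := spectral_sum_L2 L lf; have lp n := eigproj_L2 mu_haar n lf.
rewrite [X in ip _ X = _]/spectral_sum (ip_sumr (haar_fin mu_haar) _ _ lS) //.
rewrite [in RHS]/spectral_sum (ip_sumr (haar_fin mu_haar) _ _ lf) //.
apply: eq_bigr => n _; rewrite eigproj_sym // eigproj_spectral_sum // ltn_ord.
exact: ipC.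
Qed.

Lemma defectE L f : L2 f ->
  defect L f = ip f f - \sum_(n < L) ip f (eigproj n f).
Proof.
move=> lf; have lS := spectral_sum_L2 L lf; have lp n := eigproj_L2 mu_haar n lf.
rewrite /defect ip_sqrB // ip_spectral_sum // -(ip_sumr (haar_fin mu_haar) _ _ lf) //.
by rewrite -/(spectral_sum L f); ring.
Qed.

Lemma ip_eigproj_ge0 n f : L2 f -> 0 <= ip f (eigproj n f).
Proof.
move=> lf; have lp := eigproj_L2 mu_haar n lf.
have := eigproj_sym mu_haar n lf lp; rewrite eigproj_eigproj // eqxx => ->.
exact: ip_ge0.
Qed.

Lemma defect_ge0 L f : 0 <= defect L f.
Proof. exact: ip_ge0. Qed.

Lemma defect_le L f : L2 f -> defect L f <= ip f f.
Proof.
by move=> lf; rewrite defectE // gerBl sumr_ge0 // => n _; exact: ip_eigproj_ge0.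
Qed.

Lemma defectS L f : L2 f -> defect L f - defect L.+1 f = ip f (eigproj L f).
Proof. by move=> lf; rewrite !defectE // big_ord_recr /=; ring. Qed.

Lemma defect_anti L M f : L2 f -> (L <= M)%N -> defect M f <= defect L f.
Proof.
move=> lf; elim: M => [|M IHM]; first by rewrite leqn0 => /eqP ->.
rewrite leq_eqVlt => /predU1P[->//|/IHM]; apply: le_trans.
by rewrite -subr_ge0 defectS // ip_eigproj_ge0.
Qed.

Lemma defectD L f g : L2 f -> L2 g ->
  defect L (f + g) <= 2 * defect L f + 2 * defect L g.
Proof.
move=> lf lg; rewrite /defect spectral_sumD // opprD addrACA.
have lfS : L2 (f - spectral_sum L f) by apply: sq_integrableB => //; exact: spectral_sum_L2.
have lgS : L2 (g - spectral_sum L g) by apply: sq_integrableB => //; exact: spectral_sum_L2.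
rewrite (ip_sqrD lfS lgS).
have := ip_ge0 mu ((f - spectral_sum L f) - (g - spectral_sum L g)).
rewrite (ip_sqrB lfS lgS).
move: (ip _ _) (ip _ _) (ip _ _) => a b c; lra.
Qed.

Lemma defectZ L r f : L2 f -> defect L (cst r * f) = r ^+ 2 * defect L f.
Proof.
move=> lf; rewrite /defect spectral_sumZ // -mulrBr.
have lfS : L2 (f - spectral_sum L f) by apply: sq_integrableB => //; exact: spectral_sum_L2.
rewrite ipZl //; last exact: sq_integrableZ.
by rewrite ipZr // mulrA.
Qed.

(** Removing the low eigenspaces costs nothing on a function they span; the
    approximate identities of a Lipschitz function are such functions. *)
Lemma defect_lipschitz f : trace_lipschitz f -> defect L f @[L --> \oo] --> (0 : R).
Proof.
move=> [bf [C [C0 fC]]]; have lf : L2 f := sq_integrable_bounded (haar_fin mu_haar) bf.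
have lp n := eigproj_L2 mu_haar n lf.
have bound N : defect N.+1 f <= (2 * (6 * C * V)) / N.+2%:R.
  have [c cE] := approx_id_span mu_haar N.
  pose h := approx_id mu N f; have hE : h = _ := cE f lf.
  have lh : L2 h.
    rewrite hE; apply: (sq_integrable_sum (haar_fin mu_haar)) => m.
    exact: sq_integrableZ.
  have dh : defect N.+1 h = 0.
    rewrite /defect (_ : spectral_sum N.+1 h = h) ?subrr ?ip0l //.
    rewrite {1}hE /spectral_sum; under eq_bigr => n _.
      rewrite eigproj_sum //; last by move=> m; exact: sq_integrableZ.
      over.
    rewrite exchange_big hE; apply: eq_bigr => m _ /=.
    rewrite -[X in _ = _ * X](@spectral_sum_eigproj m N.+1) // /spectral_sum mulr_sumr.
    by apply: eq_bigr => n _; rewrite eigprojZ.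
  have lfh : L2 (f - h) by exact: sq_integrableB.
  have := defectD N.+1 lfh lh; rewrite subrK dh mulr0 addr0 => /le_trans; apply.
  rewrite -mulrA ler_pM2l //; apply: le_trans (defect_le N.+1 lfh) _.
  rewrite mulrAC -(haar_int_cst mu) haar_intE; apply: le_Rintegral => //.
  - exact: (sq_integrableM lfh lfh).
  - exact/(bounded_meas_integrable (haar_fin mu_haar))/bounded_meas_cst.
  - move=> x _; rewrite -expr2 -sqrrN !fctE opprB.
    exact: (approx_id_bound mu_haar).
have c0 : Num.sqrt (defect n.+1 f) @[n --> \oo] --> (0 : R).
  by apply: (sqr_dist_cvg (K := 2 * (6 * C * V))) => n; rewrite subr0 sqr_sqrtr ?defect_ge0.
have := cvgM c0 c0; rewrite mulr0 => c1.
have dE : (fun n => defect n.+1 f) = (fun n => Num.sqrt (defect n.+1 f)) \*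
    (fun n => Num.sqrt (defect n.+1 f)).
  by apply/funext => n /=; rewrite -expr2 sqr_sqrtr ?defect_ge0.
rewrite -dE in c1; have := @cvg_shiftS R (fun L => defect L f) (nbhs (0 : R)).
by move=> <-; exact: c1.
Qed.

End completeness.

(** * Completeness of the eigenspaces *)

Lemma ge0_cvg0P (R : realType) (u : nat -> R) : (forall n, 0 <= u n) ->
  u n @[n --> \oo] --> (0 : R) <->
  forall e : R, 0 < e -> exists N, forall n, (N <= n)%N -> u n <= e.
Proof.
move=> u0; split=> [/cvgrPdist_le cu e e0|H].
  have [N _ HN] := cu e e0; exists N => n /HN /=.
  by rewrite sub0r normrN ger0_norm.
apply/cvgrPdist_le => e /H[N HN]; exists N => // n /= /HN.
by rewrite sub0r normrN ger0_norm.
Qed.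

Section density.
Variables (R : realType) (mu : {measure set (SO3 R) -> \bar R}).
Hypothesis mu_haar : haar_measure mu.
Implicit Types (f g h : SO3 R -> R) (x y z : SO3 R) (A : set (SO3 R)).

Local Notation ip := (ip mu).
Local Notation L2 := (sq_integrable mu).
Local Notation defect := (defect mu).

Definition dist_to A x : R := inf [set `|SO3val x - SO3val y| | y in A].

Let dist_lb A x : has_lbound [set `|SO3val x - SO3val y| | y in A].
Proof. by exists 0 => _ [y _ <-]. Qed.

Lemma dist_to_le A x y : A y -> dist_to A x <= `|SO3val x - SO3val y|.
Proof. by move=> Ay; apply: ge_inf => //; exists y. Qed.

Lemma dist_to_ge A x (e : R) : A !=set0 ->
  (forall y, A y -> e <= `|SO3val x - SO3val y|) -> e <= dist_to A x.
Proof.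
move=> [y0 Ay0] H; apply: lb_le_inf; first by exists `|SO3val x - SO3val y0|, y0.
by move=> _ [y Ay <-]; exact: H.
Qed.

Lemma dist_to_lip A x y : A !=set0 ->
  `|dist_to A x - dist_to A y| <= `|SO3val x - SO3val y|.
Proof.
move=> A0; suff H u v : dist_to A u - dist_to A v <= `|SO3val u - SO3val v|.
  by rewrite ler_norml H andbT lerNl opprB distrC H.
rewrite lerBlDr addrC -lerBlDr; apply: dist_to_ge => // w Aw.
rewrite lerBlDr; apply: le_trans (dist_to_le u Aw) _.
by rewrite -[SO3val u - _](subrKA (SO3val v)) addrC ler_normD.
Qed.

Lemma sqr_norm_dist x y :
  `|SO3val x - SO3val y| ^+ 2 <= 2 * (3 - rot_trace x y).
Proof.
have [->|] := eqVneq `|SO3val x - SO3val y| 0.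
  by rewrite expr0n /= mulr_ge0 // subr_ge0 rot_trace_le3.
move=> /mx_norm_neq0[[i j] e]; rewrite [X in X ^+ 2]e !mxE /= real_normK ?num_real //.
by rewrite rot_traceC; exact: entry_dist.
Qed.

Lemma dist_to_continuous A : A !=set0 -> continuous (dist_to A).
Proof.
move=> A0 x; apply/(@cvgrPdist_le _ _ _ (nbhs x) (nbhs_filter x)) => e e0.
have := (@cvgrPdist_le _ _ _ (nbhs x) (nbhs_filter x) _ _).1
  (SO3val_continuous (x := x)) e e0.
apply: filterS => y; exact/le_trans/dist_to_lip.
Qed.

(** For closed A these Lipschitz functions decrease to the indicator of A. *)
Definition bump A n x : R := Num.max 0 (1 - n%:R * dist_to A x).

Lemma bump_lipschitz A n : A !=set0 -> trace_lipschitz (bump A n).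
Proof.
move=> A0; have d0 x : 0 <= dist_to A x by apply: dist_to_ge.
split.
  split.
    apply: measurable_maxr; first exact: measurable_cst.
    apply: measurable_funB; first exact: measurable_cst.
    apply: measurable_funM; first exact: measurable_cst.
    by apply: continuous_measurable_SO3; exact: dist_to_continuous.
  exists 1 => x; rewrite ger0_norm ?le_max ?lexx // ge_max ler01 /=.
  by rewrite gerBl mulr_ge0.
exists (2 * n%:R ^+ 2); split=> [|x y]; first by rewrite mulr_ge0 ?exprn_ge0.
have H : `|bump A n y - bump A n x| <= n%:R * `|SO3val x - SO3val y|.
  have := dist_to_lip y x A0; rewrite distrC => Hd.
  have : `|n%:R * dist_to A x - n%:R * dist_to A y| <= n%:R * `|SO3val x - SO3val y|.
    by rewrite -mulrBr normrM ger0_norm // ler_wpM2l // dist_to_lip.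
  rewrite /bump; move: (n%:R * dist_to A x) (n%:R * dist_to A y) (n%:R * `|_|).
  move=> a b c; rewrite !ler_norml => /andP[h1 h2].
  by case: (leP 0 (1 - b)); case: (leP 0 (1 - a)) => h3 h4; apply/andP; split; lra.
rewrite -(real_normK (num_real (_ - _))).
apply: le_trans (_ : (n%:R * `|SO3val x - SO3val y|) ^+ 2 <= _).
  by rewrite ler_sqr ?nnegrE // mulr_ge0.
rewrite exprMn [leRHS](_ : _ = n%:R ^+ 2 * (2 * (3 - rot_trace x y))); last by ring.
by rewrite ler_wpM2l ?exprn_ge0 // sqr_norm_dist.
Qed.

Lemma bump_cvg A x : closed A -> A !=set0 ->
  bump A n x @[n --> \oo] --> (\1_A x : R).
Proof.
move=> cA A0; have d0 : 0 <= dist_to A x by apply: dist_to_ge.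
have [Ax|nAx] := pselect (A x).
  have dx : dist_to A x = 0.
    apply/eqP; rewrite eq_le d0 andbT; apply: le_trans (dist_to_le x Ax) _.
    by rewrite subrr normr0.
  apply: cvg_near_cst; apply: nearW => n.
  by rewrite /bump dx mulr0 subr0 indicE mem_set // max_r.
have dx : 0 < dist_to A x.
  have : open (~` A) by exact: closed_openC.
  move=> [W oW WA]; have : W (SO3val x) by rewrite -[W _]/((@SO3val R @^-1` W) x) WA.
  move/oW/nbhs_ballP => [e /= e0 eW]; apply: lt_le_trans e0 _.
  apply: dist_to_ge => // y Ay; rewrite leNgt; apply/negP => xy.
  have : (@SO3val R @^-1` W) y.
    apply: eW; rewrite -ball_normE; exact: xy.
  by rewrite WA.
apply: cvg_near_cst; near=> n; rewrite /bump indicE memNset // max_l //.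
rewrite subr_le0 -ler_pdivrMr // mul1r.
by near: n; exact: nbhs_infty_ger.
Unshelve. all: end_near.
Qed.

Lemma SO3_measurable_closed : @measurable _ (SO3 R) = <<s (@closed (SO3 R)) >>.
Proof.
apply/seteqP; split.
  apply: smallest_sub; first exact: smallest_sigma_algebra.
  move=> U oU; rewrite -[U]setCK.
  have := (@smallest_sigma_algebra _ setT (@closed (SO3 R))).
  case=> _ + _; move/(_ (~` U)); rewrite setTD; apply.
  by apply: sub_sigma_algebra; rewrite closedC.
apply: smallest_sub; first exact: sigma_algebra_measurable.
move=> C cC; rewrite -[C]setCK; apply: measurableC.
by apply: open_measurable_SO3; rewrite openC.
Qed.

Lemma closed_setI_closed : setI_closed (@closed (SO3 R)).
Proof. by move=> A B cA cB; exact: closedI. Qed.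

(** Peter-Weyl for SO(3). The defect is a quadratic form bounded by the square of
    the L^2 norm, so the functions on which it tends to zero form a closed
    subspace. It contains the Lipschitz functions, hence the indicators of
    closed sets, hence everything. *)
Theorem defect_cvg0 f : L2 f -> defect L f @[L --> \oo] --> (0 : R).
Proof.
have fin := haar_fin mu_haar.
have limit g (F : nat -> SO3 R -> R) : L2 g -> (forall n, L2 (F n)) ->
    (forall n, defect L (F n) @[L --> \oo] --> (0 : R)) ->
    ip (g - F n) (g - F n) @[n --> \oo] --> (0 : R) ->
    defect L g @[L --> \oo] --> (0 : R).
  move=> lg lF dF gF; apply/ge0_cvg0P => [L|e e0]; first exact: defect_ge0.
  have e4 : 0 < e / 4 by rewrite divr_gt0.
  have [n /(_ n (leqnn n)) h1] := (ge0_cvg0P (fun n => ip_ge0 mu _)).1 gF _ e4.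
  have [N HN] := (ge0_cvg0P (fun L => defect_ge0 mu L _)).1 (dF n) _ e4.
  exists N => L /HN; have lgF : L2 (g - F n) by exact: sq_integrableB.
  have := defectD mu_haar L lgF (lF n); rewrite subrK.
  move: h1 (defect_le mu_haar L lgF).
  move: (defect _ _) (defect _ _) (defect _ _) (ip _ _) => a b c d.
  lra.
move: f; apply: (L2_induction (P := fun f => defect L f @[L --> \oo] --> (0 : R))
  fin SO3_measurable_closed closed_setI_closed).
- apply: (defect_lipschitz mu_haar); apply: polyf_trace_lipschitz; exact: polyf_cst.
- move=> A cA; have [->|/set0P A0] := eqVneq A set0.
    rewrite indic0; apply: (defect_lipschitz mu_haar); apply: polyf_trace_lipschitz.
    exact: polyf_cst.
  have mA : measurable A.
    by rewrite SO3_measurable_closed; exact: sub_sigma_algebra.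
  have bb n := bump_lipschitz n A0.
  have bL n : L2 (bump A n) by case: (bb n) => b _; exact: sq_integrable_bounded.
  have b1 : bounded_meas (cst 1 : SO3 R -> R) by exact: bounded_meas_cst.
  have bA : bounded_meas (\1_A : SO3 R -> R).
    by split=> //; exists 1 => x; rewrite indicE ger0_norm // lern1; case: (_ \in _).
  apply: (limit _ (bump A)) => //; first exact: sq_integrable_bounded.
    by move=> n; exact: defect_lipschitz.
  apply: (L2_dominated_cvg (sq_integrable_bounded fin b1)) => //.
  + by move=> n; case: (bb n) => -[].
  + move=> n x; rewrite /bump ger0_norm ?le_max ?lexx // ge_max ler01 /=.
    by rewrite gerBl mulr_ge0 // dist_to_ge.
  + by move=> x; exact: bump_cvg.
- move=> g h lg lh dg dh.
  apply: (@squeeze_cvgr _ _ _ _ (fun=> 0) (fun L => 2 * defect L g + 2 * defect L h)).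
  + apply: nearW => L; rewrite defect_ge0 /=; exact: defectD.
  + exact: cvg_cst.
  + have two u : defect L u @[L --> \oo] --> (0 : R) ->
        (2 * defect L u) @[L --> \oo] --> (0 : R).
      by move=> du; rewrite -[X in _ --> X](mulr0 2); exact: cvgMl_tmp du.
    by rewrite -[X in _ --> X](addr0 0); exact: cvgD (two g dg) (two h dh).
- move=> r g lg dg; under eq_fun do rewrite (defectZ mu_haar) //.
  by rewrite -[0](mulr0 (r ^+ 2)); exact: cvgMl_tmp.
- exact: limit.
Qed.

End density.

(** * The gradient controls the spectral sums *)

Section dirichlet.
Variables (R : realType) (mu : {measure set (SO3 R) -> \bar R}).
Hypothesis mu_haar : haar_measure mu.
Implicit Types (f h : SO3 R -> R) (x y z : SO3 R).

Local Notation ip := (ip mu).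
Local Notation L2 := (sq_integrable mu).
Local Notation defect := (defect mu).
Local Notation eigproj := (eigproj mu).
Local Notation spectral_sum := (spectral_sum mu).

Variables (f : SO3 R -> R) (g : 'I_3 -> SO3 R -> R).
Hypothesis lf : L2 f.
Hypothesis lg : forall k, L2 (g k).
Hypothesis weak : forall k phi, polyf phi -> ip f (D k phi) = - ip (g k) phi.

Let A M := \sum_(n < M) (n * n.+1)%:R * ip f (eigproj n f).

Let lapl_spectral_sum M : lapl (spectral_sum M f) =
  \sum_(n < M) cst (n * n.+1)%:R * eigproj n f.
Proof.
rewrite /spectral_sum lapl_sum => [|n]; last exact: polyf_eigproj.
by apply: eq_bigr => n _; exact: lapl_eigproj.
Qed.

Let lp n : L2 (eigproj n f). Proof. exact: eigproj_L2. Qed.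

Let lce n : L2 (cst (n * n.+1)%:R * eigproj n f).
Proof. exact: sq_integrableZ. Qed.

(** Expanding the square of grad f minus the gradient of the spectral sum h,
    both the cross term and the square of grad h equal the same sum over the
    eigenvalues: this is Bessel's inequality for gradients. *)
Lemma dirichlet_lower M :
  \sum_(n < M) (n * n.+1)%:R * ip f (eigproj n f) <= \sum_(k < 3) ip (g k) (g k).
Proof.
have fin := haar_fin mu_haar; pose h := spectral_sum M f.
have ph : polyf h by exact: polyf_spectral_sum.
have lh : L2 h by exact: polyf_L2.
have pD k : polyf (D k h) by exact: polyf_D.
have lD k : L2 (D k h) by exact: polyf_L2.
have cross : \sum_(k < 3) ip (g k) (D k h) = A M.
  have lDD k : L2 (D k (D k h)) by apply: (polyf_L2 mu_haar); exact: polyf_D.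
  transitivity (ip f (lapl h)); last first.
    rewrite lapl_spectral_sum (ip_sumr fin _ (fun n : 'I_M => lce n) lf).
    by apply: eq_bigr => n _; exact: (ipZr _ lf (lp n)).
  rewrite /lapl ipC ipNl //; last exact: sq_integrable_sum.
  rewrite (ip_suml fin _ lDD lf) -sumrN; apply: eq_bigr => k _.
  by rewrite ipC (ipC mu _ f) weak ?opprK // ipC.
have square : \sum_(k < 3) ip (D k h) (D k h) = A M.
  rewrite -(ip_lapl mu_haar ph ph) lapl_spectral_sum.
  rewrite (ip_suml fin _ (fun n : 'I_M => lce n) lh); apply: eq_bigr => n _.
  rewrite (ipZl _ (lp n) lh) -(eigproj_sym mu_haar n lf lh).
  by rewrite /h eigproj_spectral_sum // ltn_ord.
have : 0 <= \sum_(k < 3) ip (g k - D k h) (g k - D k h).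
  by apply: sumr_ge0 => k _; exact: ip_ge0.
under eq_bigr => k _ do rewrite (ip_sqrB (lg k) (lD k)).
rewrite !big_split /= sumrN -mulr_sumr cross square /A.
move: (\sum_(k < 3) _) (\sum_(n < M) _) => a b; lra.
Qed.

Lemma abel_defect M :
  \sum_(n < M.+1) (n * n.+1)%:R * ip f (eigproj n f) =
  \sum_(L < M) (2 * L.+1)%:R * (defect L.+1 f - defect M.+1 f).
Proof.
elim: M => [|M IHM]; first by rewrite big_ord1 big_ord0 mul0n mul0r.
have sum2 m : \sum_(L < m) (2 * L.+1)%:R = (m * m.+1)%:R :> R.
  elim: m => [|m IHm]; first by rewrite big_ord0 mul0n.
  by rewrite big_ord_recr /= IHm -natrD; congr (_%:R); ring.
rewrite big_ord_recr /= IHM -(defectS mu_haar) //.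
have E m (e : R) : \sum_(L < m) (2 * L.+1)%:R * (defect L.+1 f - e) =
    \sum_(L < m) (2 * L.+1)%:R * defect L.+1 f - (m * m.+1)%:R * e.
  by rewrite -sum2 mulr_suml -sumrB; apply: eq_bigr => L _; rewrite mulrBr.
by rewrite !E big_ord_recr /= !natrM; ring.
Qed.

(** The left side is the integral, over energies E from 0 to K * (K + 1), of the
    squared norm of the part of f above E. Abel summation of [dirichlet_lower]
    bounds it with the tail defect M.+1 subtracted, and the tail vanishes by
    completeness. *)
Lemma sum_defect_le K :
  \sum_(L < K) (2 * L.+1)%:R * defect L.+1 f <= \sum_(k < 3) ip (g k) (g k).
Proof.
set G := \sum_(k < 3) _.
pose C : R := \sum_(L < K) (2 * L.+1)%:R.
have C0 : 0 <= C by rewrite /C sumr_ge0.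
have bound M : (K <= M)%N ->
    \sum_(L < K) (2 * L.+1)%:R * defect L.+1 f - C * defect M.+1 f <= G.
  move=> KM; apply: le_trans (dirichlet_lower M.+1); rewrite abel_defect.
  rewrite /C mulr_suml -sumrB.
  rewrite -(@big_mkord _ _ _ M xpredT (fun L => (2 * L.+1)%:R * (defect L.+1 f - defect M.+1 f))).
  rewrite (big_cat_nat (n := K)) //= big_mkord.
  under eq_bigr do rewrite -mulrBr; rewrite lerDl big_nat.
  apply: sumr_ge0 => L /andP[_ LM]; rewrite mulr_ge0 // subr_ge0.
  by apply: (defect_anti mu_haar lf); rewrite ltnS ltnW.
rewrite leNgt; apply/negP => lt.
pose e := (\sum_(L < K) (2 * L.+1)%:R * defect L.+1 f - G) / (2 * (C + 1)).
have e0 : 0 < e by rewrite divr_gt0 ?subr_gt0 // mulr_gt0 // ltr_wpDl.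
have [N HN] := (ge0_cvg0P (fun L => defect_ge0 mu L f)).1 (defect_cvg0 mu_haar lf) e e0.
have := bound (maxn K N) (leq_maxl _ _).
have := HN (maxn K N).+1 (leq_trans (leq_maxr _ _) (leqnSn _)).
have eE : \sum_(L < K) (2 * L.+1)%:R * defect L.+1 f - G = 2 * (C + 1) * e.
  by rewrite /e; field; rewrite gt_eqF // ltr_wpDl.
move: eE (defect_ge0 mu (maxn K N).+1 f).
move: (defect _ _) (\sum_(L < K) _) => a b.
nra.
Qed.

End dirichlet.

(** * The pointwise inequality *)

Section pointwise_inequality.
Variable R : realType.
Implicit Types (a b t r : R).

(** Exact value of the integral of (t^3 - u^3)^2 d(u^4) from 0 to e. *)
Definition primitive t e : R :=
  t ^+ 6 * e ^+ 4 - 8 / 7 * (t ^+ 3 * e ^+ 7) + 2 / 5 * e ^+ 10.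

(** As u grows to t the integrand decreases, so its value at the left end bounds
    the increment. In the variables a, b - a, t^3 - b^3 the difference of both
    sides has nonnegative coefficients. *)
Lemma primitive_step t a b : 0 <= a -> a <= b -> b <= t ->
  primitive t b - primitive t a <= (b ^+ 4 - a ^+ 4) * (t ^+ 3 - a ^+ 3) ^+ 2.
Proof.
move=> a0 ab bt; have b0 : 0 <= b := le_trans a0 ab.
pose d := b - a; have d0 : 0 <= d by rewrite subr_ge0.
pose s := t ^+ 3 - b ^+ 3.
have s0 : 0 <= s by rewrite subr_ge0 lerXn2r ?nnegrE // (le_trans b0 bt).
have tE : t ^+ 3 = s + b ^+ 3 by rewrite /s subrK.
have t6 : t ^+ 6 = (s + b ^+ 3) ^+ 2 by rewrite -tE -exprM.
rewrite -subr_ge0 /primitive t6 tE; have -> : b = a + d by rewrite /d addrC subrK.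
set lhs := (X in 0 <= X).
have -> : lhs = 2 * s * (6 * (a ^+ 5 * d ^+ 2) + 16 * (a ^+ 4 * d ^+ 3)
    + 19 * (a ^+ 3 * d ^+ 4) + 12 * (a ^+ 2 * d ^+ 5) + 4 * (a * d ^+ 6)
    + 4 / 7 * d ^+ 7)
  + (24 * (a ^+ 7 * d ^+ 3) + 87 * (a ^+ 6 * d ^+ 4) + 726 / 5 * (a ^+ 5 * d ^+ 5)
    + 142 * (a ^+ 4 * d ^+ 6) + 610 / 7 * (a ^+ 3 * d ^+ 7)
    + 234 / 7 * (a ^+ 2 * d ^+ 8) + 52 / 7 * (a * d ^+ 9) + 26 / 35 * d ^+ 10).
  by rewrite /lhs; field.
have X k : 0 <= a ^+ k by exact: exprn_ge0.
have Y k : 0 <= d ^+ k by exact: exprn_ge0.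
have Z k l : 0 <= a ^+ k * d ^+ l by exact: mulr_ge0.
have Z1 l : 0 <= a * d ^+ l by exact: mulr_ge0.
apply: addr_ge0; first apply: mulr_ge0; first exact: mulr_ge0.
  have := (Z 5 2, Z 4 3, Z 3 4, Z 2 5, Z1 6, Y 7) => -[[[[[? ?] ?] ?] ?] ?]; lra.
have := (Z 7 3, Z 6 4, Z 5 5, Z 4 6, Z 3 7, Z 2 8, Z1 9, Y 10).
move=> -[[[[[[[? ?] ?] ?] ?] ?] ?] ?]; lra.
Qed.

Lemma primitive_end t : primitive t t = 9 / 35 * t ^+ 10.
Proof. by rewrite /primitive; field. Qed.

Lemma primitive0 t : primitive t 0 = 0.
Proof. by rewrite /primitive !expr0n /=; ring. Qed.

(** The fourth root of the eigenvalue: in this variable the fractional powers of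
    the energy become polynomials. *)
Definition level_root (L : nat) : R := Num.sqrt (Num.sqrt (L * L.+1)%:R).

Lemma level_root_ge0 L : 0 <= level_root L. Proof. exact: sqrtr_ge0. Qed.

Lemma level_rootX4 L : level_root L ^+ 4 = (L * L.+1)%:R.
Proof.
by rewrite /level_root -[4%N]/(2 * 2)%N exprM !sqr_sqrtr ?sqrtr_ge0.
Qed.

Lemma level_root_mono L : level_root L <= level_root L.+1.
Proof.
rewrite -(ler_pXn2r (n := 4)) ?nnegrE ?level_root_ge0 //.
by rewrite !level_rootX4 ler_nat leq_mul.
Qed.

(** The layer-cake sum over the spectral levels dominates the integral that a
    continuous spectrum would give. *)
Lemma level_sum_lower (alpha t : R) (kappa : nat -> R) : 0 < alpha -> 0 <= t ->
  (forall L, Num.sqrt (kappa L) <= alpha * level_root L ^+ 3) ->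
  exists M, 9 / 35 * (alpha ^+ 2 * t ^+ 10) <= \sum_(L < M)
    (2 * L.+1)%:R * (Num.max 0 (alpha * t ^+ 3 - Num.sqrt (kappa L))) ^+ 2.
Proof.
move=> al0 t0 kapl; pose c L := Num.min (level_root L) t.
have [M tM] : exists M, t <= level_root M.
  have [M HM] : exists M : nat, t ^+ 4 <= M%:R.
    by exists (Num.bound (t ^+ 4)); apply/ltW/archi_boundP; exact: exprn_ge0.
  exists M; rewrite -(ler_pXn2r (n := 4)) ?nnegrE ?level_root_ge0 //.
  rewrite level_rootX4 (le_trans HM) // ler_nat.
  by case: (M) => // m; rewrite leq_pmulr.
exists M; have c0 L : 0 <= c L by rewrite le_min level_root_ge0.
have ct L : c L <= t by rewrite ge_min lexx orbT.
have cS L : c L <= c L.+1 by rewrite le_min ct andbT ge_min level_root_mono.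
have step L : alpha ^+ 2 * (primitive t (c L.+1) - primitive t (c L)) <=
    (2 * L.+1)%:R * (Num.max 0 (alpha * t ^+ 3 - Num.sqrt (kappa L))) ^+ 2.
  have [tL|Lt] := leP t (level_root L).
    have cL : c L = t by rewrite /c min_r.
    have cL1 : c L.+1 = t by rewrite /c min_r // (le_trans tL) // level_root_mono.
    by rewrite cL cL1 subrr mulr0 mulr_ge0 // sqr_ge0.
  have cL : c L = level_root L by rewrite /c min_l // ltW.
  apply: le_trans (_ : alpha ^+ 2 * ((c L.+1 ^+ 4 - c L ^+ 4) * (t ^+ 3 - c L ^+ 3) ^+ 2) <= _).
    by rewrite ler_wpM2l ?sqr_ge0 // primitive_step.
  rewrite mulrCA -exprMn; apply: ler_pM.
  - by rewrite subr_ge0 lerXn2r ?nnegrE.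
  - exact: sqr_ge0.
  - rewrite cL level_rootX4.
    apply: le_trans (_ : level_root L.+1 ^+ 4 - (L * L.+1)%:R <= _).
      by rewrite lerD2r lerXn2r ?nnegrE ?level_root_ge0 // ge_min lexx.
    by rewrite level_rootX4 lerBlDr -natrD ler_nat; lia.
  - have d0 : 0 <= alpha * (t ^+ 3 - c L ^+ 3).
      by rewrite mulr_ge0 ?(ltW al0) // subr_ge0 lerXn2r ?nnegrE.
    rewrite ler_sqr ?nnegrE ?le_max ?lexx ?d0 //; apply/orP; right.
    by rewrite mulrBr lerD2l lerN2 cL.
apply: le_trans (_ : \sum_(L < M) alpha ^+ 2 * (primitive t (c L.+1) - primitive t (c L)) <= _);
  last by apply: ler_sum => L _.
rewrite -mulr_sumr -(big_mkord xpredT (fun L => primitive t (c L.+1) - primitive t (c L))).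
rewrite telescope_sumr // /c min_r // primitive_end.
rewrite [Num.min (level_root 0) t](_ : _ = 0) ?primitive0; last first.
  by rewrite /level_root mul0n sqrtr0 sqrtr0 min_l.
by rewrite subr0 mulrCA.
Qed.

(** Here kappa L stands for the largest density of a family spanning the levels up
    to L; the last hypothesis is the square of kappa L <= c * lambda_L^(3/2). The
    number t with rho = c * t^6 is the fourth root of the energy below which the
    low modes could carry all of rho; the constant 9/35 is the integral of
    (1 - u^3)^2 d(u^4) over the unit interval. *)
Lemma rumin_pointwise (c rho : R) (kappa : nat -> R) : 0 < c -> 0 <= rho ->
  (forall L, 0 <= kappa L) ->
  (forall L, kappa L ^+ 2 <= c ^+ 2 * ((L * L.+1)%:R) ^+ 3) ->
  exists M, 9 * rho `^ (5 / 3) <= 35 * c `^ (2 / 3) * \sum_(L < M)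
    (2 * L.+1)%:R * (Num.max 0 (Num.sqrt rho - Num.sqrt (kappa L))) ^+ 2.
Proof.
move=> c0 rho0 k0 kc; pose al := Num.sqrt c.
have al0 : 0 < al by rewrite sqrtr_gt0.
have alE : al ^+ 2 = c by rewrite sqr_sqrtr // ltW.
pose t := (rho / c) `^ (6^-1); have t0 : 0 <= t by exact: powR_ge0.
have rc0 : 0 <= rho / c by rewrite divr_ge0 // ltW.
have t6 : t ^+ 6 = rho / c.
  by rewrite -powR_mulrn // -powRrM mulVf ?pnatr_eq0 // powRr1.
have rE : Num.sqrt rho = al * t ^+ 3.
  apply/eqP; rewrite -(@eqrXn2 _ 2) ?sqrtr_ge0 ?mulr_ge0 ?exprn_ge0 ?(ltW al0) //.
  by rewrite exprMn -exprM t6 alE sqr_sqrtr // mulrC divfK // gt_eqF.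
have kl L : Num.sqrt (kappa L) <= al * level_root L ^+ 3.
  have B0 : 0 <= al * level_root L ^+ 3.
    by rewrite mulr_ge0 ?(ltW al0) // exprn_ge0 // level_root_ge0.
  rewrite -(ler_pXn2r (n := 4)) ?nnegrE ?sqrtr_ge0 //.
  rewrite -[4%N]/(2 * 2)%N exprM sqr_sqrtr // exprMn exprM alE -exprM.
  by rewrite -[(3 * _)%N]/(4 * 3)%N exprM level_rootX4.
have [M HM] := level_sum_lower al0 t0 kl.
exists M; rewrite rE.
have E : rho `^ (5 / 3) = c `^ (2 / 3) * (al ^+ 2 * t ^+ 10).
  have -> : rho = c * t ^+ 6 by rewrite t6 mulrC divfK // gt_eqF.
  rewrite powRM ?(ltW c0) ?exprn_ge0 // -(powR_mulrn 6) // -powRrM.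
  have -> : 6%:R * (5 / 3) = 10%:R :> R by field.
  have -> : c `^ (5 / 3) = c `^ (2 / 3) * c.
    rewrite -[X in _ = _ * X](powRr1 (ltW c0)) -powRD; first by congr (_ `^ _); field.
    by rewrite (gt_eqF c0) implybT.
  by rewrite powR_mulrn // alE -mulrA.
rewrite E; have p0 : 0 <= c `^ (2 / 3) by exact: powR_ge0.
have := ler_wpM2l p0 HM; lra.
Qed.

(** The left sum is the number of eigenfunctions with levels 1, .., L per unit
    volume. The constant is attained at L = 1 and fixes that of the theorem; after
    clearing denominators and putting L = m + 1 the difference of both sides is
    a polynomial in m with nonnegative coefficients. *)
Lemma kappa_bound (V : R) L : 0 < V ->
  (\sum_(n < L) (2 * n.+1 + 1)%:R ^+ 2 / V) ^+ 2 <=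
  (9 / (2 * Num.sqrt 2 * V)) ^+ 2 * ((L * L.+1)%:R) ^+ 3.
Proof.
move=> V0; rewrite -mulr_suml !expr_div_n.
have s2 : Num.sqrt 2 ^+ 2 = 2 :> R by rewrite sqr_sqrtr.
have -> : (2 * Num.sqrt 2 * V) ^+ 2 = 8 * V ^+ 2 by rewrite !exprMn s2; ring.
have key : 8 * (\sum_(n < L) (2 * n.+1 + 1)%:R ^+ 2) ^+ 2 <=
    81 * ((L * L.+1)%:R) ^+ 3 :> R.
  have S3 := sum_odd_sqr R L; set S := \sum_(n < L) _ in S3 *.
  suff : 8 * (3 * S) ^+ 2 <= 729 * ((L * L.+1)%:R) ^+ 3 by rewrite exprMn; lra.
  rewrite S3; case: {S S3} L => [|m].
    by rewrite mul0n expr0n /= mulr0 (_ : _ - 3 = 0) ?expr0n ?mulr0 //; ring.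
  set M : R := m%:R; have M0 : 0 <= M by [].
  have -> : ((m.+2) * (2 * m.+1 + 1) * (2 * m.+1 + 3))%:R =
    (M + 2) * (2 * M + 3) * (2 * M + 5) by rewrite /M; ring.
  have -> : (m.+1 * m.+2)%:R = (M + 1) * (M + 2) by rewrite /M; ring.
  rewrite -subr_ge0; set u := (X in 0 <= X).
  have -> : u = (601 * M ^+ 4 + 3823 * M ^+ 3 + 8194 * M ^+ 2 + 5940 * M) * (M + 1) ^+ 2.
    by rewrite /u; ring.
  apply: mulr_ge0; last exact: sqr_ge0.
  have := (exprn_ge0 4 M0, exprn_ge0 3 M0, exprn_ge0 2 M0) => -[[h4 h3] h2]; lra.
rewrite ler_pdivrMr ?exprn_gt0 // [leRHS](_ : _ = 81 / 8 * (L * L.+1)%:R ^+ 3).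
  lra.
by field; rewrite gt_eqF.
Qed.

End pointwise_inequality.

(** * The inequality for families of real functions *)

Section finite_families.
Variables (R : realType) (J : finType).
Implicit Types (s t : J -> R).

Lemma sum_sqr_ge0 s : 0 <= \sum_i s i ^+ 2.
Proof. by apply: sumr_ge0 => i _; exact: sqr_ge0. Qed.

Lemma cauchy_schwarz_sum s t :
  \sum_i s i * t i <= Num.sqrt (\sum_i s i ^+ 2) * Num.sqrt (\sum_i t i ^+ 2).
Proof.
set a := Num.sqrt _; set b := Num.sqrt _.
have aE : a ^+ 2 = \sum_i s i ^+ 2 by rewrite sqr_sqrtr // sum_sqr_ge0.
have bE : b ^+ 2 = \sum_i t i ^+ 2 by rewrite sqr_sqrtr // sum_sqr_ge0.
have a0 : 0 <= a := sqrtr_ge0 _; have b0 : 0 <= b := sqrtr_ge0 _.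
have H : 2 * (a * b) * (\sum_i s i * t i) <= 2 * (a * b) * (a * b).
  have := sum_sqr_ge0 (fun i => b * s i - a * t i).
  have -> : \sum_i (b * s i - a * t i) ^+ 2 =
      b ^+ 2 * \sum_i s i ^+ 2 + a ^+ 2 * \sum_i t i ^+ 2
      - 2 * (a * b) * (\sum_i s i * t i).
    rewrite !mulr_sumr -big_split -sumrB /=.
    by apply: eq_bigr => i _; ring.
  by rewrite -aE -bE; nra.
have [ab0|ab] := eqVneq (a * b) 0; last first.
  by rewrite ler_pM2l // in H; rewrite mulr_gt0 // lt_neqAle eq_sym ab mulr_ge0.
rewrite ab0 big1 // => i _; move/eqP: ab0; rewrite mulf_eq0.
have zero (r : J -> R) c : c ^+ 2 = \sum_i r i ^+ 2 -> c = 0 -> r i = 0.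
  move=> cE c0; move: cE; rewrite c0 expr0n /= => /esym/eqP.
  rewrite psumr_eq0 => [/allP/(_ i)|j _]; last exact: sqr_ge0.
  by rewrite mem_index_enum sqrf_eq0 => /(_ isT)/eqP.
by case/orP => /eqP h; [rewrite (zero s _ aE h) mul0r|rewrite (zero t _ bE h) mulr0].
Qed.

Lemma sqr_sqrt_sub_le (kappa : R) s t : \sum_i t i ^+ 2 <= kappa ->
  Num.max 0 (Num.sqrt (\sum_i s i ^+ 2) - Num.sqrt kappa) ^+ 2 <=
  \sum_i (s i - t i) ^+ 2.
Proof.
move=> tk; have kk := ler_wsqrtr tk; have cs := cauchy_schwarz_sum s t.
have -> : \sum_i (s i - t i) ^+ 2 = \sum_i s i ^+ 2 - 2 * (\sum_i s i * t i)
    + \sum_i t i ^+ 2.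
  by rewrite mulr_sumr -sumrB -big_split /=; apply: eq_bigr => i _; ring.
move: kk cs; set a := Num.sqrt (\sum_i s i ^+ 2).
set b := Num.sqrt (\sum_i t i ^+ 2); set k := Num.sqrt kappa.
have aE : a ^+ 2 = \sum_i s i ^+ 2 by rewrite sqr_sqrtr // sum_sqr_ge0.
have bE : b ^+ 2 = \sum_i t i ^+ 2 by rewrite sqr_sqrtr // sum_sqr_ge0.
have a0 : 0 <= a := sqrtr_ge0 _; have b0 : 0 <= b := sqrtr_ge0 _.
rewrite -aE -bE; move: (\sum_i _) => m bk mab.
have [h|h] := leP 0 (a - k); last by rewrite expr0n /=; have := sqr_ge0 (a - b); nra.
nra.
Qed.

End finite_families.

Section lieb_thirring.
Variables (R : realType) (mu : {measure set (SO3 R) -> \bar R}).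
Hypothesis mu_haar : haar_measure mu.
Implicit Types (f h : SO3 R -> R) (x y z : SO3 R).

Local Notation ip := (ip mu).
Local Notation L2 := (sq_integrable mu).
Local Notation V := (haar_vol mu).

(** The level n = 0 is left out: it only sees the mean, which vanishes for the
    functions under consideration. Including it would spoil the constant. *)
Definition levels_kernel L : {poly R} := \sum_(n < L) chi_kernel mu n.+1.

Definition levels_dim L : R := \sum_(n < L) (2 * n.+1 + 1)%:R ^+ 2 / V.

Lemma levels_dim_ge0 L : 0 <= levels_dim L.
Proof.
by apply: sumr_ge0 => n _; rewrite divr_ge0 // ltW // haar_vol_gt0.
Qed.

Lemma levels_kernel_norm L x :
  ip (zonal (levels_kernel L) x) (zonal (levels_kernel L) x) = levels_dim L.
Proof.
have V0 : V != 0 by rewrite gt_eqF // haar_vol_gt0.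
pose F (n : 'I_L) := cst ((2 * n.+1 + 1)%:R / V) * zonal (chi R n.+1) x.
have lF n : L2 (F n) by apply: sq_integrableZ; exact: zonal_L2.
have -> : zonal (levels_kernel L) x = \sum_n F n.
  apply/funext => y; rewrite fct_sumE /zonal /levels_kernel horner_sum.
  by apply: eq_bigr => n _; rewrite /chi_kernel hornerZ.
rewrite (ip_suml (haar_fin mu_haar) _ lF); last exact: (sq_integrable_sum (haar_fin mu_haar)).
apply: eq_bigr => n _; rewrite (ip_sumr (haar_fin mu_haar) _ lF (lF n)).
have lz m := zonal_L2 mu_haar (chi R m) x.
rewrite (bigD1 n) //= big1 ?addr0 => [|m mn]; last first.
  rewrite (ipZl _ (lz _) (lF m)) (ipZr _ (lz _) (lz _)).
  by rewrite (ip_chi_neq mu_haar) ?mulr0 // eqSS eq_sym.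
rewrite (ipZl _ (lz _) (lF n)) (ipZr _ (lz _) (lz _)) (ip_chi_eq mu_haar).
by field.
Qed.

Lemma spectral_sum_levels L f x : L2 f -> haar_int mu f = 0 ->
  spectral_sum mu L.+1 f x = ip (zonal (levels_kernel L) x) f.
Proof.
move=> lf f0; rewrite -[RHS]/(integral_op mu (zonal (levels_kernel L)) f x).
rewrite (conv_zonal_sum mu_haar) // /spectral_sum big_ord_recl !fct_sumE.
rewrite [X in X = _]/GRing.add /= (_ : eigproj mu 0 f x = 0) ?add0r ?fct_sumE //.
rewrite (eigprojE mu_haar) // fctE (_ : integral_op _ _ _ _ = 0) ?mulr0 //.
rewrite -[RHS]f0 /integral_op /haar_int ipC; congr (ip f _).
by apply/funext => y; rewrite /zonal /= hornerC.
Qed.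

Variables (J : finType) (w : J -> SO3 R -> R) (g : J -> 'I_3 -> SO3 R -> R).
Hypothesis lw : forall i, L2 (w i).
Hypothesis w0 : forall i, haar_int mu (w i) = 0.
Hypothesis lg : forall i k, L2 (g i k).
Hypothesis weak : forall i k phi, polyf phi -> ip (w i) (D k phi) = - ip (g i k) phi.
Hypothesis bessel : forall K, L2 K -> \sum_i (ip K (w i)) ^+ 2 <= ip K K.

Let rho x := \sum_i w i x ^+ 2.
Let c : R := 9 / (2 * Num.sqrt 2 * V).

Let residual L x := \sum_i (w i x - spectral_sum mu L.+1 (w i) x) ^+ 2.

Let c0 : 0 < c.
Proof. by rewrite divr_gt0 // !mulr_gt0 ?sqrtr_gt0 // haar_vol_gt0. Qed.

Let mw i : measurable_fun setT (w i). Proof. by case: (lw i). Qed.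

Let lr i L : L2 (w i - spectral_sum mu L.+1 (w i)).
Proof. by apply: sq_integrableB => //; exact: spectral_sum_L2. Qed.

(** The low-energy part at x is obtained by pairing with the kernel, so by Bessel
    its density is at most the squared norm of the kernel, whatever the size of
    the family. The rest is the triangle inequality in R^J. *)
Lemma residual_lower L x :
  Num.max 0 (Num.sqrt (rho x) - Num.sqrt (levels_dim L)) ^+ 2 <= residual L x.
Proof.
apply: sqr_sqrt_sub_le; rewrite -(levels_kernel_norm L x).
under eq_bigr do rewrite spectral_sum_levels //.
by apply: bessel; exact: zonal_L2.
Qed.

Let K : R := 35 / 9 * c `^ (2 / 3).

Let layer L x : R := K * ((2 * L.+1)%:R * residual L x).

Let K0 : 0 <= K. Proof. by rewrite mulr_ge0 // powR_ge0. Qed.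

Let residual_ge0 L x : 0 <= residual L x.
Proof. exact: sum_sqr_ge0. Qed.

Let layer_ge0 L x : 0 <= layer L x.
Proof. by do 2 (apply: mulr_ge0 => //). Qed.

Let mresidual L : measurable_fun setT (residual L).
Proof. by apply: measurable_sum => i; apply: measurable_funX; case: (lr i L). Qed.

Let mlayer L : measurable_fun setT (layer L).
Proof. by do 2 (apply: measurable_funM; first exact: measurable_cst). Qed.

Let int_residual L : (\int[mu]_x (residual L x)%:E =
  (\sum_i defect mu L.+1 (w i))%:E)%E.
Proof.
under eq_integral do rewrite /residual -sumEFin.
rewrite ge0_integral_sum //=; last first.
- by move=> i x _; rewrite lee_fin sqr_ge0.
- by move=> i; apply/measurable_EFinP; apply: measurable_funX; case: (lr i L).
rewrite -sumEFin; apply: eq_bigr => i _.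
rewrite -[LHS]fineK; last first.
  by apply: (integrable_fin_num measurableT); case: (lr i L).
by [].
Qed.

Let int_layer L : (\int[mu]_x (layer L x)%:E =
  (K * ((2 * L.+1)%:R * \sum_i defect mu L.+1 (w i)))%:E)%E.
Proof.
rewrite mulrA EFinM -int_residual -ge0_integralZl_EFin //.
- by apply: eq_integral => x _; rewrite /layer mulrA EFinM.
- by move=> x _; rewrite lee_fin.
- exact/measurable_EFinP.
- exact: mulr_ge0.
Qed.

(** Integrating the pointwise inequality, the layers add up to the spectral sums
    that the gradients control. *)
Theorem lieb_thirring_real :
  (\int[mu]_x (rho x `^ (5 / 3))%:E <=
   (K * \sum_i \sum_(k < 3) ip (g i k) (g i k))%:E)%E.
Proof.
have lower x : ((rho x `^ (5 / 3))%:E <= \sum_(L <oo) (layer L x)%:E)%E.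
  have [|M HM] := rumin_pointwise c0 (sum_sqr_ge0 (w ^~ x)) levels_dim_ge0.
    by move=> L; exact/kappa_bound/haar_vol_gt0.
  apply: (le_trans _ (nneseries_lim_ge M _)); last by move=> L _ _; rewrite lee_fin.
  rewrite sumEFin lee_fin big_mkord /layer -mulr_sumr /K.
  have : \sum_(L < M) (2 * L.+1)%:R * Num.max 0 (Num.sqrt (rho x) -
      Num.sqrt (levels_dim L)) ^+ 2 <= \sum_(L < M) (2 * L.+1)%:R * residual L x.
    by apply: ler_sum => L _; rewrite ler_wpM2l // residual_lower.
  have p0 : 0 <= c `^ (2 / 3) by exact: powR_ge0.
  move=> /(ler_wpM2l p0); move: HM; rewrite -/(rho x) -!mulrA.
  move: (c `^ _ * _) (c `^ _ * _) (_ `^ _) => a b r; lra.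
apply: (@le_trans _ _ (\int[mu]_x \sum_(L <oo) (layer L x)%:E)%E).
  apply: ge0_le_integral => //.
  - by move=> x _; rewrite lee_fin powR_ge0.
  - apply/measurable_EFinP; apply: (measurableT_comp (measurable_powR _)).
    by apply: measurable_sum => i; exact: measurable_funX.
  - apply: (ge0_emeasurable_sum (P := predT)) => [L x _ _|L _].
      by rewrite lee_fin.
    exact/measurable_EFinP.
rewrite integral_nneseries //; last first.
- by move=> L x _; rewrite lee_fin.
- by move=> L; exact/measurable_EFinP.
apply: lime_le; first by apply: is_cvg_nneseries => L _ _; rewrite integral_ge0 // => x _; rewrite lee_fin.
apply: nearW => M; under eq_bigr do rewrite int_layer.
rewrite sumEFin lee_fin big_mkord -mulr_sumr ler_wpM2l //.
under eq_bigr do rewrite mulr_sumr.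
rewrite exchange_big /=; apply: ler_sum => i _.
exact: (sum_defect_le mu_haar (lw i) (lg i) (weak i)).
Qed.

End lieb_thirring.

(** * Complex families *)

Section complex_functions.
Variables (R : realType) (mu : {measure set (SO3 R) -> \bar R}).
Hypothesis mu_haar : haar_measure mu.
Implicit Types (f : SO3 R -> R[i]) (x : SO3 R).

Local Notation ip := (ip mu).

Definition re_part f : SO3 R -> R := fun x => complex.Re (f x).
Definition im_part f : SO3 R -> R := fun x => complex.Im (f x).

Lemma sqr_normc (z : R[i]) :
  ComplexField.Normc.normc z ^+ 2 = complex.Re z ^+ 2 + complex.Im z ^+ 2.
Proof. by case: z => a b /=; rewrite sqr_sqrtr // addr_ge0 ?sqr_ge0. Qed.

Lemma L2_parts f : L2 mu f -> [/\ sq_integrable mu (re_part f),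
  sq_integrable mu (im_part f) &
  L2norm2 mu f = (ip (re_part f) (re_part f) + ip (im_part f) (im_part f))%:E].
Proof.
move=> [mr mi fin].
have nE : L2norm2 mu f = (\int[mu]_x (re_part f x ^+ 2 + im_part f x ^+ 2)%:E)%E.
  by apply: eq_integral => x _; rewrite sqr_normc.
have mr2 : measurable_fun setT (fun x => re_part f x ^+ 2) by exact: measurable_funX.
have mi2 : measurable_fun setT (fun x => im_part f x ^+ 2) by exact: measurable_funX.
have i2 : mu.-integrable setT (fun x => (re_part f x ^+ 2 + im_part f x ^+ 2)%:E).
  apply/integrableP; split; first by apply/measurable_EFinP; exact: measurable_funD.
  rewrite (eq_integral (fun x => (re_part f x ^+ 2 + im_part f x ^+ 2)%:E)) -?nE //.
  by move=> x _; rewrite gee0_abs // lee_fin addr_ge0 ?sqr_ge0.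
have ir : sq_integrable mu (re_part f).
  split=> //; apply: le_integrable i2 => //; first exact/measurable_EFinP.
  by move=> x _ /=; rewrite lee_fin !ger0_norm ?addr_ge0 ?sqr_ge0 // lerDl sqr_ge0.
have ii : sq_integrable mu (im_part f).
  split=> //; apply: le_integrable i2 => //; first exact/measurable_EFinP.
  by move=> x _ /=; rewrite lee_fin !ger0_norm ?addr_ge0 ?sqr_ge0 // lerDr sqr_ge0.
split=> //; rewrite nE -[LHS]fineK; last exact: (integrable_fin_num measurableT).
congr (_%:E); rewrite -[LHS]/(\int[mu]_x (re_part f x ^+ 2 + im_part f x ^+ 2)).
by rewrite RintegralD //; [case: ir|case: ii].
Qed.

Lemma weak_D_parts k f h : is_weak_D mu k f h -> forall phi, polyf phi ->
  ip (re_part f) (D k phi) = - ip (re_part h) phi /\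
  ip (im_part f) (D k phi) = - ip (im_part h) phi.
Proof.
move=> [_ wD] phi /polyf_smooth/wD e.
have Re_mul (z : R[i]) (r : R) : complex.Re (z * r%:C%C) = complex.Re z * r.
  by case: z => a b /=; rewrite mulr0 subr0.
have Im_mul (z : R[i]) (r : R) : complex.Im (z * r%:C%C) = complex.Im z * r.
  by case: z => a b /=; rewrite mulr0 add0r.
split.
  have := congr1 (@complex.Re R) e; rewrite /cintegral /= => e1.
  transitivity (\int[mu]_x complex.Re (f x * (D k phi x)%:C%C)).
    by apply: eq_Rintegral => x _; rewrite Re_mul.
  by rewrite e1; congr (- _); apply: eq_Rintegral => x _; rewrite Re_mul.
have := congr1 (@complex.Im R) e; rewrite /cintegral /= => e1.
transitivity (\int[mu]_x complex.Im (f x * (D k phi x)%:C%C)).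
  by apply: eq_Rintegral => x _; rewrite Im_mul.
by rewrite e1; congr (- _); apply: eq_Rintegral => x _; rewrite Im_mul.
Qed.

Lemma weak_DP k f : H1 mu f -> is_weak_D mu k f (weak_D mu k f).
Proof. by move=> [_ /(_ k) ex]; exact: (xgetPex (fun=> 0) ex). Qed.

Lemma grad_norm2E f : H1 mu f -> grad_norm2 mu f =
  (\sum_(k < 3) (ip (re_part (weak_D mu k f)) (re_part (weak_D mu k f)) +
                 ip (im_part (weak_D mu k f)) (im_part (weak_D mu k f))))%:E.
Proof.
move=> hf; rewrite /grad_norm2 -sumEFin; apply: eq_bigr => k _.
rewrite (_ : (fun x => grad mu f x ord0 k) = weak_D mu k f); last first.
  by apply/funext => x; rewrite /grad mxE.
by have [lD _] := weak_DP k hf; have [_ _ ->] := L2_parts lD.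
Qed.

Variables (N : nat) (psi : 'I_N -> SO3 R -> R[i]).
Hypothesis psi_L2 : forall j, L2 mu (psi j).
Hypothesis psi_orthonormal : orthonormal_family mu psi.

Let u j := re_part (psi j).
Let v j := im_part (psi j).
Let lu j : sq_integrable mu (u j). Proof. by have [] := L2_parts (psi_L2 j). Qed.
Let lv j : sq_integrable mu (v j). Proof. by have [] := L2_parts (psi_L2 j). Qed.

Lemma orthonormal_parts j k :
  ip (u j) (u k) + ip (v j) (v k) = (j == k)%:R /\
  ip (v j) (u k) = ip (u j) (v k).
Proof.
have e := psi_orthonormal j k.
have Re_mul (z z' : R[i]) : complex.Re (z * z'^*%C) =
    complex.Re z * complex.Re z' + complex.Im z * complex.Im z'.
  by case: z z' => a b [a' b'] /=; rewrite mulrN opprK.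
have Im_mul (z z' : R[i]) : complex.Im (z * z'^*%C) =
    complex.Im z * complex.Re z' - complex.Re z * complex.Im z'.
  by case: z z' => a b [a' b'] /=; rewrite mulrN addrC.
split.
  rewrite -RintegralD ?sq_integrableM //.
  have := congr1 (@complex.Re R) e; rewrite /cintegral /=.
  under eq_Rintegral do rewrite Re_mul.
  by move=> ->; case: (j == k).
apply/eqP; rewrite -subr_eq0 -RintegralB ?sq_integrableM //.
have := congr1 (@complex.Im R) e; rewrite /cintegral /=.
under eq_Rintegral do rewrite Im_mul.
by move=> ->; case: (j == k).
Qed.

Lemma ip_comb (a b c d : R) (f1 f2 h1 h2 : SO3 R -> R) :
  sq_integrable mu f1 -> sq_integrable mu f2 ->
  sq_integrable mu h1 -> sq_integrable mu h2 ->
  ip (cst a * f1 + cst b * f2) (cst c * h1 + cst d * h2) =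
  a * c * ip f1 h1 + a * d * ip f1 h2 + b * c * ip f2 h1 + b * d * ip f2 h2.
Proof.
move=> l1 l2 m1 m2.
have la := sq_integrableZ a l1; have lb := sq_integrableZ b l2.
have lc := sq_integrableZ c m1; have ld := sq_integrableZ d m2.
rewrite (ipDl la lb (sq_integrableD lc ld)) (ipDr la lc ld) (ipDr lb lc ld).
rewrite (ipZl _ l1 lc) (ipZl _ l1 ld) (ipZl _ l2 lc) (ipZl _ l2 ld).
rewrite (ipZr _ l1 m1) (ipZr _ l1 m2) (ipZr _ l2 m1) (ipZr _ l2 m2).
move: (ip _ _) (ip _ _) (ip _ _) (ip _ _) => *; ring.
Qed.

(** Bessel's inequality for the complex orthonormal family, in real coordinates:
    h1 and h2 are the real and imaginary parts of the projection of K. *)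
Lemma bessel_parts K : sq_integrable mu K ->
  \sum_j (ip K (u j) ^+ 2 + ip K (v j) ^+ 2) <= ip K K.
Proof.
move=> lK; have fin := haar_fin mu_haar.
pose a j := ip K (u j); pose b j := ip K (v j).
pose F j := cst (a j) * u j + cst (b j) * v j.
pose G j := cst (a j) * v j + cst (- b j) * u j.
have lF j : sq_integrable mu (F j) by apply: sq_integrableD; exact: sq_integrableZ.
have lG j : sq_integrable mu (G j) by apply: sq_integrableD; exact: sq_integrableZ.
pose h1 := \sum_j F j; pose h2 := \sum_j G j.
have l1 : sq_integrable mu h1 by exact: sq_integrable_sum.
have l2 : sq_integrable mu h2 by exact: sq_integrable_sum.
set S := \sum_j _.
have cross : ip K h1 = S.
  rewrite (ip_sumr fin _ lF lK); apply: eq_bigr => j _.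
  rewrite (ipDr lK (sq_integrableZ _ (lu j)) (sq_integrableZ _ (lv j))).
  by rewrite (ipZr _ lK (lu j)) (ipZr _ lK (lv j)) !expr2.
have square : ip h1 h1 + ip h2 h2 = S.
  rewrite (ip_suml fin _ lF l1) (ip_suml fin _ lG l2) -big_split /=.
  apply: eq_bigr => j _; rewrite (ip_sumr fin _ lF (lF j)) (ip_sumr fin _ lG (lG j)).
  rewrite -big_split /= (bigD1 j) //= big1 ?addr0 => [|k kj].
    have [e1 e2] := orthonormal_parts j j; rewrite eqxx /= in e1.
    rewrite /F /G !ip_comb // -/(a j) -/(b j) e2.
    transitivity ((a j ^+ 2 + b j ^+ 2) * (ip (u j) (u j) + ip (v j) (v j))).
      move: (ip _ _) (ip _ _) (ip _ _) => *; ring.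
    by rewrite e1 mulr1.
  have [e1 e2] := orthonormal_parts j k; rewrite eq_sym (negPf kj) /= in e1.
  rewrite /F /G !ip_comb // e2.
  transitivity ((a j * a k + b j * b k) * (ip (u j) (u k) + ip (v j) (v k))).
    move: (ip _ _) (ip _ _) (ip _ _) => *; ring.
  by rewrite e1 mulr0.
have := ip_ge0 mu h2; have := ip_ge0 mu (K - h1); rewrite (ip_sqrB lK l1) cross.
clear cross; move: square; clearbody S.
move: (ip _ _) (ip _ _) (ip _ _) => p q r; lra.
Qed.

End complex_functions.

Lemma lieb_thirring_constant (R : realType) (V : R) : 0 < V ->
  35 / 9 * (9 / (2 * Num.sqrt 2 * V)) `^ (2 / 3) =
  35 / (2 * 3 `^ (2 / 3) * V `^ (2 / 3)).
Proof.
move=> V0.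
have cube (r : R) : 0 <= r -> (r `^ (2 / 3)) ^+ 3 = r ^+ 2.
  by move=> r0; rewrite -!powR_mulrn ?powR_ge0 // -powRrM; congr (_ `^ _); field.
set A := (9 / (2 * Num.sqrt 2 * V)) `^ (2 / 3).
set B : R := 3 `^ (2 / 3); set C := V `^ (2 / 3).
have s2 : Num.sqrt 2 ^+ 2 = 2 :> R by rewrite sqr_sqrtr.
have s0 : 0 < Num.sqrt 2 :> R by rewrite sqrtr_gt0.
have B0 : 0 < B by exact: powR_gt0.
have C0 : 0 < C by exact: powR_gt0.
have B3 : B ^+ 3 = 9 by rewrite cube //; ring.
have C3 : C ^+ 3 = V ^+ 2 by rewrite cube // ltW.
have A3 : A ^+ 3 = 81 / (8 * V ^+ 2).
  rewrite cube; last by rewrite divr_ge0 // !mulr_ge0 // ltW.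
  rewrite expr_div_n !exprMn s2; field; rewrite gt_eqF //.
(* Both sides are nonnegative, so it is enough to compare their cubes. *)
suff -> : A = 9 / (2 * B * C).
  by field; rewrite !gt_eqF.
apply/eqP; rewrite -(@eqrXn2 _ 3) ?powR_ge0 //; last first.
  by rewrite divr_ge0 // !mulr_ge0 // ltW.
rewrite A3 expr_div_n !exprMn B3 C3; apply/eqP; field; rewrite gt_eqF //.
Qed.

(** A complex family of N functions is treated as the real family of its 2N real
    and imaginary parts. Orthonormality enters only through Bessel's inequality
    against real functions. *)
Theorem lieb_thirring_SO3 (R : realType) (mu : {measure set (SO3 R) -> \bar R})
    (N : nat) (psi : 'I_N -> SO3 R -> R[i]) :
  haar_measure mu -> (forall j, H1 mu (psi j)) -> orthonormal_family mu psi ->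
  (forall j, cintegral mu (psi j) = 0) ->
  (\int[mu]_x (density psi x `^ (5 / 3))%:E <=
   (35 / (2 * 3 `^ (2 / 3) * haar_vol mu `^ (2 / 3)))%:E *
     \sum_(j < N) grad_norm2 mu (psi j))%E.
Proof.
move=> haar hH1 orth mean0.
have l2 j : L2 mu (psi j) by case: (hH1 j).
pose part (b : bool) (f : SO3 R -> R[i]) := if b then re_part f else im_part f.
pose w (i : 'I_N * bool) := part i.2 (psi i.1).
pose g (i : 'I_N * bool) k := part i.2 (weak_D mu k (psi i.1)).
have sum_parts (F : 'I_N -> bool -> R) :
    \sum_(i : 'I_N * bool) F i.1 i.2 = \sum_j (F j true + F j false).
  by rewrite -(pair_bigA _ F); apply: eq_bigr => j _; rewrite big_bool.
have lw i : sq_integrable mu (w i).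
  by case: i => j b; have [lr li _] := L2_parts (l2 j); case: b.
have lg i k : sq_integrable mu (g i k).
  case: i => j b; have [lD _] := weak_DP k (hH1 j).
  by have [lr li _] := L2_parts lD; case: b.
have w0 i : haar_int mu (w i) = 0.
  case: i => j b; rewrite haar_intE; have := mean0 j; rewrite /cintegral => e.
  by case: b; [exact: (congr1 (@complex.Re R) e)|exact: (congr1 (@complex.Im R) e)].
have weak i k phi : polyf phi -> ip mu (w i) (D k phi) = - ip mu (g i k) phi.
  case: i => j b pphi; have [e1 e2] := weak_D_parts (weak_DP k (hH1 j)) pphi.
  by case: b.
have bessel K : sq_integrable mu K -> \sum_i ip mu K (w i) ^+ 2 <= ip mu K K.
  move=> lK; rewrite (sum_parts (fun j b => ip mu K (part b (psi j)) ^+ 2)).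
  exact: bessel_parts.
have := lieb_thirring_real haar lw w0 lg weak bessel.
rewrite lieb_thirring_constant ?haar_vol_gt0 // EFinM.
have -> : (\sum_i \sum_(k < 3) ip mu (g i k) (g i k))%:E =
    (\sum_(j < N) grad_norm2 mu (psi j))%E.
  rewrite (sum_parts (fun j b => \sum_(k < 3)
    ip mu (part b (weak_D mu k (psi j))) (part b (weak_D mu k (psi j))))).
  rewrite -sumEFin; apply: eq_bigr => j _.
  by rewrite grad_norm2E // -big_split.
have dE x : \sum_i w i x ^+ 2 = density psi x.
  rewrite /density (sum_parts (fun j b => part b (psi j) x ^+ 2)).
  by apply: eq_bigr => j _; rewrite sqr_normc.
by under eq_integral do rewrite dE.
Qed.


Theorem theorem1p3 (R : realType) (mu : {measure set (SO3 R) -> \bar R})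
    (N : nat) (psi : 'I_N -> SO3 R -> R[i])
    (N_gt0 : (0 < N)%N)
    (mu_haar : haar_measure mu)
    (psi_H1 : forall j, H1 mu (psi j))
    (psi_orthonormal : orthonormal_family mu psi)
    (psi_mean0 : forall j, cintegral mu (psi j) = 0) :
  (mu [set: SO3 R] = 1%:E ->
     (\int[mu]_x (density psi x `^ (5 / 3))%:E
        <= (35 / (2 * 3 `^ (2 / 3)))%:E * \sum_(j < N) grad_norm2 mu (psi j))%E)
  /\
  (mu [set: SO3 R] = (pi ^+ 2)%:E ->
     (\int[mu]_x (density psi x `^ (5 / 3))%:E
        <= (35 / (2 * 3 `^ (2 / 3) * pi `^ (4 / 3)))%:E
           * \sum_(j < N) grad_norm2 mu (psi j))%E).
Proof.
have LT := lieb_thirring_SO3 mu_haar psi_H1 psi_orthonormal psi_mean0.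
split=> muE; move: LT; rewrite /haar_vol muE /=.
  by rewrite powR1 mulr1.
rewrite -(powR_mulrn 2 (pi_ge0 R)) -powRrM.
by rewrite (_ : 2%:R * (2 / 3) = 4 / 3) //; field.
Qed.
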